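(* Fix constants $0<\gamma_0\le 1$ and $\mu_0>0$. For each integer $t\ge 1$, let $X_1,\dots,X_t$ be independent random variables with $0\le X_j\le 1$, and suppose there are deterministic integers $M=M(t)$ and $1=s_1<s_2<\cdots<s_M=t$ and numbers $m(1),\dots,m(M-1)$ such that $\mathbb{E}X_j=m(k)$ for each $s_k\le j<s_{k+1}$ and $1\le k\le M-1$, and such that $$\min_{k}(s_{k+1}-s_k)\ge t^{\gamma_0}\quad\text{and}\quad \min_k m(k)\ge \mu_0 .$$ Let $0<\beta<\gamma<\gamma_0$ and $0<\delta<\frac{\gamma-\beta}{1-\beta}$. Let $Z_1,\dots,Z_t$ be independent Bernoulli random variables, independent of $(X_j)$, with $\mathbb{P}(Z_j=1)=j^{-\beta}=1-\mathbb{P}(Z_j=0)$. Let $\mathcal{E}(t)=\{1\le j\le t: Z_j=1\}$ and let $T(1)<T(2)<\cdots<T(w)$ be its elements. For $l\ge1$ let $\alpha_l=1-l^{-\delta}$, set $Y_0=0$ and define recursively $Y_l=\alpha_lY_{l-1}+(1-\alpha_l)X_{T(l)}$ for $1\le l\le w$. Then there are constants $b,\theta>0$ (not depending on $t$) such that, for all sufficiently large $t$, $$\mathbb{P}(E_{good})\ge 1-\exp(-t^{\theta}),$$ where $E_{good}$ is the event that both (i) $\#\mathcal{E}(t)\le \frac{4t^{1-\beta}}{1-\beta}$, and (ii) $|Y_l-m(k)|\le \frac{m(k)}{t^{b}}$ for every $1\le k\le M-1$ and every $l$ with $s_k+t^{\gamma}\le T(l)<s_{k+1}$.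
   Context: The intervals $s_k\le j<s_{k+1}$ are called epochs and the $s_k$ transition times; the sequence $(X_j)$ is piecewise stationary in mean. $\#A$ denotes the cardinality of a set $A$. The constants $\gamma_0,\mu_0,\beta,\gamma,\delta$ are fixed independently of $t$, while the sequences, $M$, the $s_k$ and the $m(k)$ may depend on $t$. *)

(* Defs.v *)
From HB Require Import structures.
From mathcomp Require Import all_boot all_order all_algebra.
From mathcomp Require Import all_classical all_reals all_analysis.
Set Implicit Arguments. Unset Strict Implicit. Unset Printing Implicit Defensive.
Import Order.TTheory GRing.Theory Num.Theory.
Local Open Scope ring_scope.
Local Open Scope classical_set_scope.

(* Mutual independence of a finite family V of real random variables:
   each is measurable, and for every family of Borel sets B the joint
   probability is the product (taking B i = setT recovers all subfamilies). *)
Definition mutually_independent {d} {T : measurableType d} {R : realType}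
  (P : probability T R) (n : nat) (V : 'I_n -> T -> R) : Prop :=
  (forall i, measurable_fun setT (V i)) /\
  forall B : 'I_n -> set R, (forall i, measurable (B i)) ->
    P (\bigcap_(i in [set: 'I_n]) (V i @^-1` B i)) =
    \big[*%E/1%E]_(i < n) P (V i @^-1` B i).

Definition joint_family {T : Type} {R : Type} (t : nat)
  (X Z : nat -> T -> R) : 'I_(t + t) -> T -> R :=
  fun i => if (i < t)%N then X (i.+1) else Z ((i - t).+1).

Definition Eset {T : Type} {R : realType} (Z : nat -> T -> R) (t : nat) (w : T)
  : seq nat := [seq j <- iota 1 t | Z j w == 1].

(* T(l), for 1 <= l <= w := #E(t) *)
Definition Tsel {T : Type} {R : realType} (Z : nat -> T -> R) (t : nat) (w : T)
  (l : nat) : nat := nth 0%N (Eset Z t w) l.-1.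

Definition alpha {R : realType} (delta : R) (l : nat) : R :=
  1 - (l%:R) `^ (- delta).

Fixpoint Yseq {T : Type} {R : realType} (delta : R) (X Z : nat -> T -> R)
  (t : nat) (w : T) (l : nat) : R :=
  match l with
  | 0 => 0
  | l'.+1 => alpha delta l'.+1 * Yseq delta X Z t w l'
             + (1 - alpha delta l'.+1) * X (Tsel Z t w l'.+1) w
  end.

Definition Egood {T : Type} {R : realType} (beta gamma delta b : R)
  (X Z : nat -> T -> R) (t M : nat) (s : nat -> nat) (m : nat -> R) : set T :=
  [set w |
    ((size (Eset Z t w))%:R <= 4 * (t%:R `^ (1 - beta)) / (1 - beta)) /\
    (forall k l : nat, (1 <= k)%N -> (k <= M - 1)%N ->
       (1 <= l)%N -> (l <= size (Eset Z t w))%N ->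
       (s k)%:R + t%:R `^ gamma <= (Tsel Z t w l)%:R ->
       (Tsel Z t w l < s k.+1)%N ->
       `|Yseq delta X Z t w l - m k| <= m k / t%:R `^ b)].
Arguments joint_family {T R} t X Z _ _.

(* Main.v *)
Require Import Defs.
From HB Require Import structures.
From mathcomp Require Import all_boot all_order all_algebra.
From mathcomp Require Import all_classical all_reals all_analysis.
From mathcomp Require Import measurable_realfun.
From mathcomp Require Import zify ring lra.
Import Order.TTheory GRing.Theory Num.Theory.
Local Open Scope ring_scope.
Local Open Scope classical_set_scope.

(** Condition on which times are selected. For a fixed selection, [Y_l] is a
    linear combination of the [X_{T(i)}], [i <= l], whose weights and whose sum
    of squared weights are at most [l^-delta]; a Chernoff bound therefore keeps
    it within [eps], of order [t^-b], of the same average taken of the means,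
    up to probability [2 exp (- eps^2 l^delta / 8)]. Inside an epoch the average
    of the means moves towards [m k] by the factor [1 - i^-delta] at each
    selected time. Chernoff bounds for the Bernoulli variables give at most
    [4 t^(1-beta) / (1-beta)] selected times in all, and at least
    [t^(gamma-beta) / 8] of them in every window of length about [t^gamma], so
    after [t^gamma] steps in the epoch the remaining bias is at most
    [exp (- c t^(gamma-beta-delta(1-beta)))], which is smaller than [eps]. *)

(** * Exponentially weighted averages along a fixed selection *)

Section ewma.
Context {R : realType}.
Implicit Types (delta : R) (e : seq nat) (x : nat -> R).

(** The selection [e] is detached from the randomness, so that one operator, linear in [x], acts
    both on the observed values and on their means. The [l]-th selected time sits at position [l.-1]
    of the list. *)
Fixpoint ewma delta e x (l : nat) : R :=
  if l is l'.+1 then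
    alpha delta l * ewma delta e x l' + (1 - alpha delta l) * x (nth 0%N e l')
  else 0.

Lemma Yseq_ewma (T : Type) delta (X Z : nat -> T -> R) t w l :
  Yseq delta X Z t w l = ewma delta (Eset Z t w) (X ^~ w) l.
Proof. by elim: l => //= l ->. Qed.

Lemma natr_powRN_itv delta n : 0 <= delta -> (0 < n)%N ->
  0 < (n%:R : R) `^ (- delta) <= 1.
Proof.
move=> d0 n0; rewrite powR_gt0 ?ltr0n//=.
have n1 : 1 <= n%:R :> R by rewrite ler1n.
by have := ler_powR n1 (_ : - delta <= 0); rewrite powRr0 oppr_le0; apply.
Qed.

Lemma alpha_itv delta n : 0 <= delta -> (0 < n)%N -> 0 <= alpha delta n <= 1.
Proof. by move=> d0 n0; rewrite /alpha; have := natr_powRN_itv _ _ d0 n0; lra. Qed.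

Lemma alpha_le_expR delta n : alpha delta n <= expR (- n%:R `^ (- delta)).
Proof. exact: expR_ge1Dx. Qed.

Lemma le_natr_powRN delta m n : 0 <= delta -> (0 < m)%N -> (m <= n)%N ->
  (n%:R : R) `^ (- delta) <= m%:R `^ (- delta).
Proof.
move=> d0 m0 mn; have n0 : (0 < n)%N by apply: leq_trans mn.
rewrite !powRN lef_pV2 ?posrE ?powR_gt0 ?ltr0n//.
by rewrite ge0_ler_powR// ?nnegrE ?ler0n// ler_nat.
Qed.

Lemma powR_le1_ge (x a : R) : 0 <= x <= 1 -> 0 < a <= 1 -> x <= x `^ a.
Proof.
move=> /andP[x0 x1] /andP[a0 a1].
have [->|xN0] := eqVneq x 0; first exact: powR_ge0.
have xp : 0 < x by rewrite lt_neqAle eq_sym xN0.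
by rewrite -[leLHS]powRr1//; apply: ger_powR => //; rewrite xp x1.
Qed.

(** After division by [n.+1%:R ^ delta], the fractions n/(n+1) and 1/(n+1) lie in [0,1], where
    raising to a power at most 1 only increases them, and they sum to 1. *)
Lemma natr_powR_succ delta n : 0 < delta <= 1 -> (0 < n)%N ->
  ((n.+1)%:R : R) `^ delta <= n%:R `^ delta + 1.
Proof.
move=> d01 n0; have nn0 : 0 < (n.+1)%:R :> R by rewrite ltr0n.
have E (m : nat) : (m%:R : R) `^ delta = n.+1%:R `^ delta * (m%:R / n.+1%:R) `^ delta.
  by rewrite -powRM ?divr_ge0// mulrCA divff ?mulr1// gt_eqF.
have E1 := E 1%N; rewrite powR1 in E1.
rewrite [in leRHS]E [X in _ + X]E1 -mulrDr ler_peMr ?powR_ge0//.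
have h (m : nat) : (m <= n.+1)%N -> 0 <= (m%:R / n.+1%:R : R) <= 1.
  by move=> mn; rewrite divr_ge0//= ler_pdivrMr// mul1r ler_nat.
apply: le_trans (lerD (powR_le1_ge _ _ (h n (leqnSn _)) d01)
  (powR_le1_ge _ _ (h 1%N isT) d01)).
by rewrite -mulrDl natr1 divff// gt_eqF.
Qed.

(** With u = (n+1)^delta and v = n^delta this reduces to u - 1 <= v. It is what keeps every damped
    old weight below the newest one. *)
Lemma alpha_powRN_le delta n : 0 < delta <= 1 -> (0 < n)%N ->
  alpha delta n.+1 * n%:R `^ (- delta) <= n.+1%:R `^ (- delta).
Proof.
move=> d01 n0; have := natr_powR_succ _ _ d01 n0; rewrite /alpha !powRN.
have := powR_gt0 delta (_ : 0 < n%:R :> R); rewrite ltr0n => /(_ n0).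
have := powR_gt0 delta (_ : 0 < n.+1%:R :> R); rewrite ltr0n => /(_ isT).
move: (n.+1%:R `^ delta) (n%:R `^ delta) => u v u0 v0 uv.
have -> : (1 - u^-1) * v^-1 = u^-1 * ((u - 1) / v).
  by field; rewrite !gt_eqF.
rewrite ler_piMr ?invr_ge0 ?(ltW u0)//.
by rewrite ler_pdivrMr// mul1r; lra.
Qed.

Lemma ewma_sub delta e x y l :
  ewma delta e (fun j => x j - y j) l = ewma delta e x l - ewma delta e y l.
Proof. by elim: l => [|l IH] /=; rewrite ?subr0// IH; ring. Qed.

Lemma ewma_itv delta e x l : 0 <= delta -> (l <= size e)%N ->
  (forall j, j \in e -> 0 <= x j <= 1) -> 0 <= ewma delta e x l <= 1.
Proof.
move=> d0 le xe; elim: l le => [_|l IH le] /=; first by rewrite lexx ler01.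
have := IH (ltnW le); have := xe _ (mem_nth 0%N le).
have := alpha_itv _ _ d0 (ltn0Sn l).
move: (alpha _ _) (x _) (ewma _ _ _ _) => a u v.
move=> /andP[a0 a1] /andP[u0 u1] /andP[v0 v1].
by apply/andP; split; nra.
Qed.

(* The newest weight l^-delta is the largest, because l^delta <= (l-1)^delta + 1.
   The sum runs over a superset r of the selected times so that it can later be
   taken over all times, whatever the selection. *)
Lemma ewma_weights delta (r : seq nat) e l : 0 < delta <= 1 ->
  uniq r -> uniq e -> {subset e <= r} -> (0 < l <= size e)%N ->
  exists c : nat -> R,
    [/\ forall x, ewma delta e x l = \sum_(j <- r) c j * x j,
        forall j, 0 <= c j <= l%:R `^ (- delta) &
        \sum_(j <- r) c j ^+ 2 <= l%:R `^ (- delta)].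
Proof.
move=> d01 ur ue er /andP[l0 le].
have d0 : 0 <= delta by case/andP: d01 => /ltW.
(* The induction also needs the coefficients to vanish off the first [l] selected times: the next
   time then has old coefficient 0, and no cross term appears in the squares. *)
suff [c [? ? ? _]] : exists c : nat -> R,
    [/\ forall x, ewma delta e x l = \sum_(j <- r) c j * x j,
        forall j, 0 <= c j <= l%:R `^ (- delta),
        \sum_(j <- r) c j ^+ 2 <= l%:R `^ (- delta) &
        forall j, j \notin take l e -> c j = 0] by exists c.
case: l l0 le => // l _; elim: l => [|l IH] le.
  have rT : nth 0%N e 0 \in r by apply: er; apply: mem_nth.
  (* Since 1^(-delta) = 1, the first step has [alpha delta 1 = 0] and the average is exactly the
     first selected value. *)
  exists (fun j => (j == nth 0%N e 0)%:R); split.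
  - move=> x; rewrite (bigD1_seq _ rT ur)/= eqxx mul1r big1 ?addr0 => [|j /negbTE->].
      by rewrite /alpha powR1; ring.
    by rewrite mul0r.
  - by move=> j; rewrite powR1; case: (_ == _); rewrite ?lexx ?ler01.
  - rewrite (bigD1_seq _ rT ur)/= eqxx expr1n big1 ?addr0 ?powR1// => j /negbTE->.
    by rewrite expr0n.
  - move=> j; case: e le {ue er rT} => //= a e _.
    by rewrite take0 inE => /negbTE->.
have [c [cE c01 c2 c0]] := IH (ltnW le).
set T := nth 0%N e l.+1; set q : R := l.+2%:R `^ (- delta).
have rT : T \in r by apply: er; apply: mem_nth.
have /andP[q0 q1] : 0 < q <= 1 by exact: natr_powRN_itv.
have qE : q = 1 - alpha delta l.+2 by rewrite /alpha /q; ring.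
have a01 := alpha_itv delta l.+2 d0 isT.
have cT : c T = 0.
  apply: c0; apply/negP => /(nthP 0%N)[i]; rewrite size_take le => il.
  rewrite nth_take// => /eqP; rewrite nth_uniq// ?(ltn_eqF il)//.
  exact: ltn_trans le.
have ac := alpha_powRN_le _ _ d01 (ltn0Sn l).
exists (fun j => alpha delta l.+2 * c j + q * (j == T)%:R); split.
- move=> x; rewrite -[LHS]/(alpha delta l.+2 * ewma delta e x l.+1 + (1 - alpha delta l.+2) * x T).
  rewrite -qE cE mulr_sumr.
  under [RHS]eq_bigr do rewrite mulrDl.
  rewrite big_split/=; congr +%R; first by apply: eq_bigr => j _; rewrite mulrA.
  rewrite (bigD1_seq _ rT ur)/= eqxx mulr1 big1 ?addr0// => j /negbTE->.
  by rewrite mulr0 mul0r.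
- move=> j; have [->|jT] := eqVneq j T; first by rewrite cT mulr0 add0r mulr1 (ltW q0) lexx.
  rewrite mulr0 addr0; case/andP: (c01 j) => cj0 cj1.
  case/andP: a01 => a0 a1; rewrite mulr_ge0//=.
  by apply: le_trans ac; rewrite ler_wpM2l.
- have E j : (alpha delta l.+2 * c j + q * (j == T)%:R) ^+ 2 =
      alpha delta l.+2 ^+ 2 * c j ^+ 2 + q ^+ 2 * (j == T)%:R.
    have [->|jT] := eqVneq j T; first by rewrite cT expr0n/= !mulr0 !add0r !mulr1.
    by rewrite !mulr0 !addr0 exprMn.
  under eq_bigr do rewrite E.
  rewrite big_split/= -!mulr_sumr.
  rewrite [X in _ + _ * X](bigD1_seq _ rT ur)/= eqxx [X in _ + _ * (_ + X)]big1 ?addr0 => [|j /negbTE->//].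
  rewrite mulr1 expr2 -mulrA.
  case/andP: a01 => a0 a1.
  (* One factor alpha turns the previous bound into at most [q]; the remaining alpha q + q^2 equals
     [q] because alpha = 1 - q. *)
  apply: (@le_trans _ _ (alpha delta l.+2 * q + q ^+ 2)).
    rewrite lerD2r ler_wpM2l//; apply: le_trans ac.
    by rewrite ler_wpM2l.
  by rewrite -/q qE le_eqVlt; apply/orP; left; apply/eqP; ring.
- move=> j; rewrite (take_nth 0%N)// mem_rcons inE negb_or => /andP[/negbTE jT jn].
  by rewrite -/T jT c0// !mulr0 addr0.
Qed.

(** Each step with input [m] multiplies the error by some alpha_i <= exp(-i^(-delta)) <=
    exp(-L^(-delta)). Keeping [L] apart from [a + n] fixes the rate throughout the induction. *)
Lemma ewma_contract delta e x (m : R) a n L : 0 <= delta -> (a + n <= L)%N ->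
  (forall i, (a <= i < a + n)%N -> x (nth 0%N e i) = m) ->
  `|ewma delta e x a - m| <= 1 ->
  `|ewma delta e x (a + n) - m| <= expR (- (n%:R * L%:R `^ (- delta))).
Proof.
move=> d0; elim: n => [|n IH] aL xm ya; first by rewrite addn0 mul0r oppr0 expR0.
rewrite addnS /= xm ?addnS ?leq_addr ?leqnn//.
have -> : alpha delta (a + n).+1 * ewma delta e x (a + n) +
   (1 - alpha delta (a + n).+1) * m - m =
   alpha delta (a + n).+1 * (ewma delta e x (a + n) - m) by ring.
have /andP[a0 _] := alpha_itv delta (a + n).+1 d0 isT.
have -> : - (n.+1%:R * L%:R `^ (- delta)) =
  - L%:R `^ (- delta) + - (n%:R * L%:R `^ (- delta)) :> R by rewrite -natr1; ring.
rewrite normrM (ger0_norm a0) expRD ler_pM//.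
  apply: le_trans (alpha_le_expR _ _) _; rewrite ler_expR lerN2.
  by apply: le_natr_powRN => //; rewrite -addnS.
apply: IH => //; first by rewrite addnS in aL; exact: ltnW.
by move=> i /andP[ai ian]; apply: xm; rewrite ai addnS ltnS ltnW.
Qed.

End ewma.

(** * Positions of the selected times relative to a window *)

Section selected_times.
Variables (p : pred nat) (t s n : nat).
Hypotheses (s0 : (0 < s)%N) (snt : (s + n <= t.+1)%N).

Let e := [seq j <- iota 1 t | p j].
Let a := size [seq j <- iota 1 s.-1 | p j].

Lemma filter_iota_split : e = [seq j <- iota 1 s.-1 | p j] ++
  [seq j <- iota s n | p j] ++ [seq j <- iota (s + n) (t.+1 - (s + n)) | p j].
Proof.
rewrite /e -!filter_cat; congr [seq j <- _ | p j].
have {1}-> : t = (s.-1 + (n + (t.+1 - (s + n))))%N by lia.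
by rewrite !iotaD add1n prednK.
Qed.

(** The first [a] entries of [e] are exactly the selected times before [s], so position [a] is where
    the window can begin. *)
Lemma nth_filter_iota_ge i : (a <= i < size e)%N -> (s <= nth 0%N e i)%N.
Proof.
have E : e = [seq j <- iota 1 s.-1 | p j] ++ [seq j <- iota s (t.+1 - s) | p j].
  rewrite /e -filter_cat; congr [seq j <- _ | p j].
  have {1}-> : t = (s.-1 + (t.+1 - s))%N by lia.
  by rewrite iotaD add1n prednK.
move=> /andP[ai ie]; rewrite E nth_cat ltnNge ai/=.
have : nth 0%N [seq j <- iota s (t.+1 - s) | p j] (i - a) \in
    [seq j <- iota s (t.+1 - s) | p j].
  by apply: mem_nth; rewrite ltn_subLR// -size_cat -E.
by rewrite mem_filter mem_iota => /andP[_ /andP[]].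
Qed.

(** By contraposition: a smaller index falls in the first two blocks of the splitting, all of whose
    entries are below [s + n]. *)
Lemma nth_filter_iota_count i : (s + n <= nth 0%N e i)%N ->
  (a + size [seq j <- iota s n | p j] <= i)%N.
Proof.
apply: contraTT; rewrite -!ltnNge filter_iota_split catA -filter_cat -size_cat => isz.
rewrite -filter_cat in isz *; rewrite nth_cat isz.
have := mem_nth 0%N isz; rewrite mem_filter mem_cat !mem_iota.
rewrite add1n prednK//; case/andP => _ /orP[|] /andP[_ //].
by move/leq_trans; apply; apply: leq_addr.
Qed.

End selected_times.

Lemma nth_filter_iota_mono (p : pred nat) t (e := [seq j <- iota 1 t | p j]) i j :
  (i <= j < size e)%N -> (nth 0%N e i <= nth 0%N e j)%N.
Proof.
move=> /andP[ij je]; have se : sorted ltn e.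
  by apply: sorted_filter (iota_ltn_sorted _ _); apply: ltn_trans.
have [->//|ij'] := eqVneq i j; apply: ltnW.
by apply: (sorted_ltn_nth ltn_trans) => //; rewrite ?inE; lia.
Qed.

(** * Chernoff bounds for Bernoulli patterns *)

Section bernoulli_patterns.
Context {R : realType} {t : nat}.
Implicit Types (p h : 'I_t -> R) (b : {ffun 'I_t -> bool}).

(** The probability of the outcome [b] for independent Bernoulli trials with parameters [p]; index
    [i] stands for time [i.+1]. *)
Definition pattern_weight p b : R := \prod_i (if b i then p i else 1 - p i).

Lemma pattern_weight_ge0 p b : (forall i, 0 <= p i <= 1) -> 0 <= pattern_weight p b.
Proof. by move=> p01; apply: prodr_ge0 => i _; have := p01 i; case: (b i); lra. Qed.

(** Distributivity of the product over the two choices at each index; this is the generating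
    function of the random selection. *)
Lemma sum_pattern_weight_prod p h :
  \sum_b pattern_weight p b * \prod_(i | b i) h i = \prod_i (p i * h i + (1 - p i)).
Proof.
pose F (i : 'I_t) (x : bool) := if x then p i * h i else 1 - p i.
transitivity (\sum_(b : {ffun 'I_t -> bool}) \prod_i F i (b i)).
  apply: eq_bigr => b _; rewrite [\prod_(i | b i) _]big_mkcond -big_split/=.
  by apply: eq_bigr => i _; rewrite /F; case: (b i); rewrite ?mulr1.
by rewrite -bigA_distr_bigA/=; apply: eq_bigr => i _; rewrite big_bool.
Qed.

Lemma sum_pattern_weight p : \sum_b pattern_weight p b = 1.
Proof.
transitivity (\sum_b pattern_weight p b * \prod_(i | b i) 1).
  by apply: eq_bigr => b _; rewrite big1 ?mulr1.
by rewrite sum_pattern_weight_prod big1// => i _; ring.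
Qed.

(** Markov's inequality for the multiplicative statistic given by [h], followed by 1 + x <= exp x in
    each factor. Both tails come from suitable [h] and [C]. *)
Lemma pattern_weight_chernoff p h (E : pred {ffun 'I_t -> bool}) (C : R) :
  (forall i, 0 <= p i <= 1) -> (forall i, 0 <= h i) ->
  (forall b, E b -> 1 <= C * \prod_(i | b i) h i) ->
  0 <= C ->
  \sum_(b | E b) pattern_weight p b <= C * expR (\sum_i p i * (h i - 1)).
Proof.
move=> p01 h0 hE C0.
apply: (@le_trans _ _ (\sum_b C * (pattern_weight p b * \prod_(i | b i) h i))).
  rewrite big_mkcond; apply: ler_sum => b _.
  have w0 := pattern_weight_ge0 _ b p01.
  case: ifPn => [/hE|_]; last by rewrite !mulr_ge0//; apply: prodr_ge0.
  by move=> H; rewrite mulrCA ler_peMr.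
rewrite -mulr_sumr sum_pattern_weight_prod ler_wpM2l// expR_sum.
apply: ler_prod => i _; apply/andP; split.
  by have := p01 i; have := h0 i; move=> ? /andP[? ?]; rewrite addr_ge0 ?mulr_ge0// subr_ge0.
by apply: le_trans (expR_ge1Dx _); lra.
Qed.

Lemma expR_half_le2 : expR (2^-1 : R) <= 2.
Proof.
have := expR_ge1Dx (- 2^-1 : R); rewrite expRN => h.
have e0 := expR_gt0 (2^-1 : R).
suff : expR 2^-1 * 2^-1 <= expR 2^-1 * (expR 2^-1)^-1 :> R.
  by rewrite mulfV ?gt_eqF//; lra.
by rewrite ler_pM2l//; lra.
Qed.

(** From exp(-y) >= 1 - y one gets exp(y) (1 - y) <= 1, while (1 - y)(1 + y + 2y^2) = 1 + y^2 (1 -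
    2y) >= 1. *)
Lemma expR_le_quadratic (y : R) : y <= 2^-1 -> expR y <= 1 + y + 2 * y ^+ 2.
Proof.
move=> y2; have := expR_ge1Dx (- y); rewrite expRN => h.
have e0 := expR_gt0 y; set e := expR y in h e0 *.
have h1 : e * (1 - y) <= 1.
  by apply: (@le_trans _ _ (e * e^-1)); rewrite ?ler_pM2l// mulfV ?gt_eqF.
have : 1 <= (1 - y) * (1 + y + 2 * y ^+ 2) by nra.
nra.
Qed.

Lemma pattern_upper_tail p (Q : R) : (forall i, 0 <= p i <= 1) ->
  \sum_i p i <= Q ->
  \sum_(b : {ffun 'I_t -> bool} | 4 * Q < #|[pred i | b i]|%:R) pattern_weight p b
    <= expR (- Q).
Proof.
move=> p01 pQ.
have -> : expR (- Q) = expR (- (2 * Q)) * expR Q by rewrite -expRD; congr expR; ring.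
(* More than 4Q selected indices make exp(count/2 - 2Q) at least 1, and exp(1/2) - 1 <= 1 leaves the
   exponent -2Q + Q. *)
apply: le_trans (pattern_weight_chernoff p (fun=> expR 2^-1) _ (expR (- (2 * Q))) p01 _ _ _) _.
- by move=> i; exact: expR_ge0.
- move=> b bQ; rewrite prodr_const -expRM_natl -expRD -expR0 ler_expR.
  by move: bQ; rewrite expR0; lra.
- exact: expR_ge0.
rewrite ler_wpM2l ?expR_ge0// ler_expR; apply: le_trans pQ; apply: ler_sum => i _.
by rewrite ler_piMr//; [have /andP[] := p01 i | have := expR_half_le2; lra].
Qed.

Lemma pattern_lower_tail p (J : pred 'I_t) (mu : R) : (forall i, 0 <= p i <= 1) ->
  mu <= \sum_(i | J i) p i ->
  \sum_(b : {ffun 'I_t -> bool} | #|[pred i | b i & J i]|%:R < mu / 4) pattern_weight p b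
    <= expR (- (mu / 4)).
Proof.
move=> p01 pQ.
have -> : expR (- (mu / 4)) = expR (mu / 4) * expR (- (mu / 2)).
  by rewrite -expRD; congr expR; field.
(* Only indices in [J] are tilted. Since exp(-1) <= 1/2, each contributes at most -p_i/2 to the
   exponent, so the total is at most mu/4 - mu/2. *)
pose h (i : 'I_t) : R := if J i then expR (-1) else 1.
apply: le_trans (pattern_weight_chernoff p h _ (expR (mu / 4)) p01 _ _ _) _.
- by move=> i; rewrite /h; case: ifP => _ //; exact: expR_ge0.
- move=> b bQ; rewrite /h -big_mkcondr/= prodr_const -expRM_natl -expRD.
  by rewrite -{1}(expR0 R) ler_expR; lra.
- exact: expR_ge0.
rewrite ler_wpM2l ?expR_ge0// ler_expR.
apply: (@le_trans _ _ (\sum_(i | J i) - (p i / 2))).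
  rewrite [leRHS]big_mkcond; apply: ler_sum => i _.
  rewrite /h; case: (J i) => /=; last by rewrite subrr mulr0.
  have := expR_ge1Dx (1 : R); have := p01 i; rewrite expRN => /andP[p0 _] h1.
  have e0 := expR_gt0 (1 : R).
  have : (expR 1)^-1 <= 2^-1 :> R by rewrite lef_pV2 ?posrE//; lra.
  nra.
by rewrite sumrN lerN2 -mulr_suml; lra.
Qed.

End bernoulli_patterns.

(** * Independence *)

Section independence.
Context {d : measure_display} {T : measurableType d} {R : realType}.
Variable P : probability T R.
Import HBNNSimple.
Local Open Scope ereal_scope.

(** Extension from indicators to simple functions through their level sets, then to [V] by monotone
    convergence. It serves to replace one indicator factor of a product by the variable itself. *)
Lemma integral_proportional (g V : T -> R) (C : R) :
  measurable_fun setT g -> measurable_fun setT V ->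
  (forall w, 0 <= g w)%R -> (forall w, 0 <= V w)%R -> (0 <= C)%R ->
  (forall B : set R, measurable B ->
    \int[P]_w (g w * \1_B (V w))%:E = C%:E * P (V @^-1` B)) ->
  \int[P]_w (g w * V w)%:E = C%:E * \int[P]_w (V w)%:E.
Proof.
move=> mg mV g0 V0 C0 H.
have mi (B : set R) : measurable B -> measurable_fun setT (fun w => \1_B (V w) : R).
  by move=> mB; apply: (measurableT_comp _ mV); exact: measurable_indic.
have simple (k : {nnsfun R >-> R}) :
    \int[P]_w (g w * k (V w))%:E = C%:E * \int[P]_w (k (V w))%:E.
  have mk y : measurable (k @^-1` [set y]) by exact: measurable_funPTI.
  have E (h : T -> R) : measurable_fun setT h -> (forall w, 0 <= h w)%R ->
      \int[P]_w (h w * k (V w))%:E =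
      \sum_(y \in range k) (y%:E * \int[P]_w (h w * \1_(k @^-1` [set y]) (V w))%:E).
    move=> mh h0.
    transitivity (\int[P]_w \sum_(y \in range k)
        (h w * (y * \1_(k @^-1` [set y]) (V w)))%:E).
      by apply: eq_integral => w _; rewrite {1}(fimfunE k) mulr_fsumr fsumEFin.
    rewrite ge0_integral_fsum//=; last 2 first.
    - move=> y; apply/measurable_EFinP; apply: measurable_funM => //.
      by apply: measurable_funM => //; exact: mi.
    - move=> y w _; rewrite lee_fin mulr_ge0//.
      by have := nnfun_muleindic_ge0 k y (V w); rewrite lee_fin.
    apply: eq_fsbigr => y /set_mem[z _ <-].
    under eq_integral do rewrite mulrCA EFinM.
    rewrite ge0_integralZl_EFin//.
    - by move=> w _; rewrite lee_fin mulr_ge0.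
    - by apply/measurable_EFinP; apply: measurable_funM => //; exact: mi.
  rewrite E//; have := E (cst 1%R).
  under eq_integral do rewrite mul1r.
  move=> -> //; rewrite ge0_mule_fsumr; last first.
    (* Nonnegativity is demanded for every real [y]; outside the range of [k] the level set is empty
       and the integral vanishes. *)
    move=> y; have [yk|yk] := pselect (exists x, k x = y).
      case: yk => x <-; rewrite mule_ge0 ?lee_fin//.
      by apply: integral_ge0 => w _; rewrite lee_fin mul1r.
    rewrite (_ : \int[P]_w _ = 0) ?mule0// integral0_eq// => w _.
    rewrite mul1r indicE; case: (boolP (_ \in _)) => // /set_mem kV.
    by case: yk; exists (V w).
  apply: eq_fsbigr => y _; rewrite H// muleCA; congr (_ * (_ * _)).
  under eq_integral do rewrite mul1r.
  by rewrite -[in LHS](setIT (V @^-1` _)) -integral_indic// -[X in measurable X]setTI; exact: mV.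
(* The absolute value is nonnegative on the whole line, hence approximable from below, and it agrees
   with the identity on the values of [V]. *)
have mf : measurable_fun setT (fun x : R => (`|x|)%:E).
  by apply/measurable_EFinP; exact: normr_measurable.
pose k := nnsfun_approx measurableT mf.
have kV w : (k n (V w))%:E @[n --> \oo] --> (V w)%:E.
  rewrite -[in X in _ --> X](ger0_norm (V0 w)).
  exact: (@cvg_nnsfun_approx _ _ _ _ measurableT _ mf).
have ndk w : {homo (fun n => k n (V w)) : n m / (n <= m)%N >-> (n <= m)%R}.
  by move=> n m nm; have /lefP := nd_nnsfun_approx measurableT mf nm; exact.
have mk n : measurable_fun setT (fun w => k n (V w)) by exact: measurableT_comp.
have limk (h : T -> R) : measurable_fun setT h -> (forall w, 0 <= h w)%R ->
    \int[P]_w (h w * k n (V w))%:E @[n --> \oo] --> \int[P]_w (h w * V w)%:E.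
  move=> mh h0.
  have -> : \int[P]_w (h w * V w)%:E =
      \int[P]_w limn (fun n => (h w * k n (V w))%:E).
    apply: eq_integral => w _; apply/esym/cvg_lim => //.
    under eq_fun do rewrite EFinM.
    by rewrite EFinM; apply: cvgeZl.
  apply: (@cvg_monotone_convergence _ _ _ P _ measurableT (fun n w => (h w * k n (V w))%:E)).
  - by move=> n; apply/measurable_EFinP; apply: measurable_funM.
  - by move=> n w _; rewrite lee_fin mulr_ge0.
  - by move=> w _ n m nm; rewrite lee_fin ler_wpM2l// ndk.
have L1 := limk g mg g0.
have L2 := limk (cst 1%R) (measurable_cst _) (fun=> ler01).
have {}L1 : C%:E * \int[P]_w (k n (V w))%:E @[n --> \oo] --> \int[P]_w (g w * V w)%:E.
  by under eq_fun do rewrite -simple.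
have {L2} : C%:E * \int[P]_w (k n (V w))%:E @[n --> \oo] --> C%:E * \int[P]_w (V w)%:E.
  apply: cvgeZl => //; move: L2; under eq_integral do rewrite mul1r.
  by under eq_fun do (under eq_integral do rewrite mul1r).
by move=> L2; apply: (cvg_unique _ L1 L2).
Qed.

Lemma indic_bigcap_prod (I : finType) (A : I -> set T) w :
  \1_(\bigcap_(i in [set: I]) A i) w = (\prod_(i : I) \1_(A i) w)%R :> R.
Proof.
have [Aw|/existsNP[i /not_implyP[_ Aiw]]] := pselect (forall i, [set: I] i -> A i w).
  rewrite indicE mem_set// big1// => i _; rewrite indicE mem_set//; exact: Aw.
by rewrite (bigD1 i)//= !indicE (memNset Aiw) mul0r memNset//; apply: contra_not Aiw => /(_ i); apply.
Qed.

(** Induction on the number [k] of factors that are already the variables themselves, the others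
    being indicators of arbitrary Borel sets. For [k = 0] this is the definition of independence,
    for [k = n] the claim. *)
Lemma integral_prod_independent (n : nat) (V : 'I_n -> T -> R) (e : 'I_n -> R) :
  mutually_independent P V -> (forall i w, 0 <= V i w)%R ->
  (forall i, \int[P]_w (V i w)%:E = (e i)%:E) ->
  \int[P]_w (\prod_i V i w)%:E = (\prod_i e i)%:E.
Proof.
move=> [mV iV] V0 eV.
have mVi i (B : set R) : measurable B -> measurable (V i @^-1` B).
  by move=> mB; rewrite -[X in measurable X]setTI; exact: mV.
pose F (B : 'I_n -> set R) k (i : 'I_n) w : R := if (i < k)%N then V i w else \1_(B i) (V i w).
pose f (B : 'I_n -> set R) k (i : 'I_n) : R := if (i < k)%N then e i else fine (P (V i @^-1` B i)).
have F0 B k i w : (0 <= F B k i w)%R by rewrite /F; case: ifP.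
have f0 B k i : (0 <= f B k i)%R.
  rewrite /f; case: ifP => _; last exact: fine_ge0.
  by rewrite -lee_fin -eV integral_ge0// => w _; rewrite lee_fin.
have mF B k i : (forall i, measurable (B i)) -> measurable_fun setT (F B k i).
  move=> mB; rewrite /F; case: (i < k)%N => //=.
  by apply: (measurableT_comp _ (mV i)); exact: measurable_indic.
suff H k : forall B : 'I_n -> set R, (forall i, measurable (B i)) ->
    \int[P]_w (\prod_i F B k i w)%:E = (\prod_i f B k i)%:E.
  have := H n (fun=> setT) (fun=> measurableT).
  rewrite (eq_bigr e) => [<-|i _]; last by rewrite /f ltn_ord.
  by apply: eq_integral => w _; congr EFin; apply: eq_bigr => i _; rewrite /F ltn_ord.
elim: k => [|k IH] B mB.
  transitivity (P (\bigcap_(i in [set: 'I_n]) (V i @^-1` B i))).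
    rewrite -[X in P X]setIT -integral_indic//; last first.
      by apply: fin_bigcap_measurable => // i _; exact: mVi.
    by apply: eq_integral => w _; rewrite indic_bigcap_prod.
  rewrite iV// -prodEFin; apply: eq_bigr => i _.
  by rewrite /f/= fineK// fin_num_measure// ; exact: mVi.
have [kn|nk] := ltnP k n; last first.
  rewrite -[RHS](_ : (\prod_i f B k i)%:E = _); last first.
    by congr EFin; apply: eq_bigr => i _; rewrite /f !(leq_trans (ltn_ord i))// ltnW.
  rewrite -IH//; apply: eq_integral => w _; congr EFin; apply: eq_bigr => i _.
  by rewrite /F !(leq_trans (ltn_ord i))// ltnW.
pose k' := Ordinal kn.
pose B' (B0 : set R) i := if i == k' then B0 else B i.
have FS (i : 'I_n) : i != k' -> (i < k.+1)%N = (i < k)%N.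
  by move=> ik; rewrite ltnS leq_eqVlt -[X in X || _](_ : (i == k') = _)// (negbTE ik).
transitivity (\int[P]_w ((\prod_(i | i != k') F B k i w) * V k' w)%:E).
  apply: eq_integral => w _; congr EFin; rewrite (bigD1 k')//= mulrC.
  by rewrite [F _ _ k' _]/F ltnSn; congr *%R; apply: eq_bigr => i ik; rewrite /F FS.
rewrite (bigD1 k')//= [f _ _ k']/f ltnSn mulrC EFinM -eV.
rewrite (eq_bigr (f B k)) => [|i ik]; last by rewrite /f FS.
apply: integral_proportional => //.
- under eq_fun do rewrite -big_filter.
  by apply: measurable_prod => i _; exact: mF.
- by move=> w; apply: prodr_ge0.
- by apply: prodr_ge0.
(* Proportionality is checked by the induction hypothesis with the set at coordinate [k] replaced by
   [B0], which is why that hypothesis quantifies over all families. *)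
move=> B0 mB0; have mB' i : measurable (B' B0 i) by rewrite /B'; case: ifP.
transitivity (\int[P]_w (\prod_i F (B' B0) k i w)%:E).
  apply: eq_integral => w _; congr EFin; rewrite [RHS](bigD1 k')//= mulrC.
  rewrite [F _ _ k' _]/F ltnn /B' eqxx; congr *%R.
  by apply: eq_bigr => i ik; rewrite /F (negbTE ik).
rewrite IH// (bigD1 k')//= [f _ _ k']/f ltnn /B' eqxx mulrC EFinM fineK; last first.
  by rewrite fin_num_measure//; exact: mVi.
by congr (_%:E * _); apply: eq_bigr => i ik; rewrite /f (negbTE ik).
Qed.

Lemma mutually_independent_comp (n : nat) (V : 'I_n -> T -> R) (h : 'I_n -> R -> R) :
  (forall i, measurable_fun setT (h i)) -> mutually_independent P V ->
  mutually_independent P (fun i w => h i (V i w)).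
Proof.
move=> mh [mV iV]; split=> [i|B mB]; first exact: measurableT_comp.
apply: (iV (fun i => h i @^-1` B i)) => i.
by rewrite -[X in measurable X]setTI; exact: mh.
Qed.

End independence.

(** * Exponential bound jointly with a fixed selection pattern *)

Section selection_patterns.
Context {d : measure_display} {T : measurableType d} {R : realType}.
Variables (P : probability T R) (t : nat) (X Z : nat -> T -> R) (p : 'I_t -> R).
Hypothesis indep : mutually_independent P (joint_family t X Z).
Hypothesis X01 : forall j w, (1 <= j <= t)%N -> 0 <= X j w <= 1.
Hypothesis PZ : forall i : 'I_t, P [set w | Z i.+1 w = 1] = (p i)%:E.

Definition pattern_of w : {ffun 'I_t -> bool} := [ffun i : 'I_t => Z i.+1 w == 1].

Let mean j := fine 'E_P[X j].

Lemma joint_family_lshift (i : 'I_t) : joint_family t X Z (lshift t i) = X i.+1.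
Proof. by rewrite /joint_family /= ltn_ord. Qed.

Lemma joint_family_rshift (i : 'I_t) : joint_family t X Z (rshift t i) = Z i.+1.
Proof. by rewrite /joint_family /= ltnNge leq_addr /= addKn. Qed.

Lemma measurable_X j : (1 <= j <= t)%N -> measurable_fun setT (X j).
Proof.
case: j => // j /= jt; rewrite -(joint_family_lshift (Ordinal jt)).
exact: (indep.1 _).
Qed.

Lemma measurable_Z (i : 'I_t) : measurable_fun setT (Z i.+1).
Proof. rewrite -joint_family_rshift; exact: (indep.1 _). Qed.

Lemma integral_X j : (1 <= j <= t)%N -> (\int[P]_w (X j w)%:E = (mean j)%:E)%E.
Proof.
move=> jt; rewrite /mean unlock fineK// fin_numElt; apply/andP; split.
  apply: (@lt_le_trans _ _ 0%E) => //; apply: integral_ge0 => w _.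
  by rewrite lee_fin; case/andP: (X01 j w jt).
apply: (@le_lt_trans _ _ (\int[P]_w (cst 1%:E w))%E); last first.
  by rewrite integral_cst// mul1e -ge0_fin_numE// fin_num_measure.
apply: ge0_le_integral => //.
- by move=> w _; rewrite lee_fin; case/andP: (X01 j w jt).
- by apply/measurable_EFinP; exact: measurable_X.
- by move=> w _; rewrite lee_fin; case/andP: (X01 j w jt).
Qed.

Lemma mean_itv j : (1 <= j <= t)%N -> 0 <= mean j <= 1.
Proof.
move=> jt; rewrite -!lee_fin -integral_X//; apply/andP; split.
  by apply: integral_ge0 => w _; rewrite lee_fin; case/andP: (X01 j w jt).
apply: (@le_trans _ _ (\int[P]_w (cst 1%:E w))%E); last first.
  by rewrite integral_cst// mul1e probability_le1.
apply: ge0_le_integral => //.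
- by move=> w _; rewrite lee_fin; case/andP: (X01 j w jt).
- by apply/measurable_EFinP; exact: measurable_X.
- by move=> w _; rewrite lee_fin; case/andP: (X01 j w jt).
Qed.

Lemma pattern_setE b : [set w | pattern_of w = b] =
  \bigcap_(i in [set: 'I_t]) (Z i.+1 @^-1` [set x | (x == 1) = b i]).
Proof.
apply/seteqP; split=> [w /= <- i _|w wb] /=; first by rewrite ffunE.
by apply/ffunP => i; rewrite ffunE; exact: wb.
Qed.

Lemma measurable_eq1 (c : bool) : measurable [set x : R | (x == 1) = c].
Proof.
case: c; first by rewrite (_ : mkset _ = [set 1])//; apply/seteqP; split=> x /= /eqP.
rewrite (_ : mkset _ = ~` [set 1]); first exact: measurableC.
by apply/seteqP; split=> x /=; [move=> /negbT/eqP | move=> /eqP/negbTE].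
Qed.

Lemma measurable_pattern b : measurable [set w | pattern_of w = b].
Proof.
rewrite pattern_setE; apply: fin_bigcap_measurable => // i _.
by rewrite -[X in measurable X]setTI; apply: measurable_Z => //; exact: measurable_eq1.
Qed.

(** A pattern records only whether the variable equals 1, so its false case is the complement of
    that event. *)
Lemma prob_Z_eq1 (i : 'I_t) (c : bool) :
  P (Z i.+1 @^-1` [set x | (x == 1) = c]) = (if c then p i else 1 - p i)%:E.
Proof.
have E : Z i.+1 @^-1` [set x | (x == 1) = true] = [set w | Z i.+1 w = 1].
  by apply/seteqP; split=> w /= /eqP.
case: c; first by rewrite E.
rewrite (_ : _ @^-1` _ = ~` [set w | Z i.+1 w = 1]).
  rewrite probability_setC ?PZ// -E -[X in measurable X]setTI.
  by apply: measurable_Z => //; exact: measurable_eq1.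
by apply/seteqP; split=> w /=; [move=> /negbT/eqP | move=> /eqP/negbTE].
Qed.

(* On y <= 1/2 we have exp y <= 1 + y + 2 y^2; bounding y^2 by a constant
   majorizes each exponential by an affine function of X_j, so that the
   independent product only sees the means. *)
Lemma pattern_hoeffding b (c : nat -> R) (eps lam : R) : 0 <= lam ->
  (forall j, `|lam * c j| <= 2^-1) ->
  (P [set w | pattern_of w = b /\
       (eps <= \sum_(j <- iota 1 t) c j * (X j w - mean j))%R] <=
   (pattern_weight p b *
     expR (- (lam * eps) + 2 * lam ^+ 2 * \sum_(j <- iota 1 t) c j ^+ 2))%:E)%E.
Proof.
move=> lam0 lc.
pose u (i : 'I_t) := lam * c i.+1.
have u2 i : - 2^-1 <= u i <= 2^-1 by rewrite -ler_norml; exact: lc.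
pose q (i : 'I_t) (x : R) := 1 + u i * (x - mean i.+1) + 2 * u i ^+ 2.
(* The first half carries the affine majorants, the second the indicators of agreement with [b].
   Truncation at 0 makes the factors nonnegative by construction and is inactive at the values taken
   by [X]. *)
pose h (i : 'I_(t + t)) (x : R) : R := match fintype.split i with
  | inl i1 => Num.max 0 (q i1 x)
  | inr i2 => \1_[set x | (x == 1) = b i2] x end.
have hl i x : h (lshift t i) x = Num.max 0 (q i x) by rewrite /h (unsplitK (inl i)).
have hr i x : h (rshift t i) x = \1_[set x | (x == 1) = b i] x.
  by rewrite /h (unsplitK (inr i)).
have i1t (i : 'I_t) : (1 <= i.+1 <= t)%N by rewrite /= ltn_ord.
have qexp (i : 'I_t) w : expR (u i * (X i.+1 w - mean i.+1)) <= q i (X i.+1 w).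
  have /andP[X0 X1] := X01 _ w (i1t i); have /andP[m0 m1] := mean_itv _ (i1t i).
  have /andP[ul ur] := u2 i.
  apply: le_trans (expR_le_quadratic _ _) _; first by nra.
  rewrite /q lerD2l ler_pM2l// exprMn ler_piMr ?sqr_ge0//.
  by rewrite expr2; nra.
have q0 (i : 'I_t) w : 0 <= q i (X i.+1 w) by apply: le_trans (qexp i w); exact: expR_ge0.
pose V := joint_family t X Z.
have iW : mutually_independent P (fun i w => h i (V i w)).
  apply: mutually_independent_comp indep => i.
  rewrite /h; case: (fintype.split i) => j.
    apply: measurable_maxr => //; rewrite /q.
    apply: measurable_funD => //; apply: measurable_funD => //.
    by apply: measurable_funM => //; exact: measurable_funB.
  by apply: measurable_indic; exact: measurable_eq1.
have W0 i w : 0 <= h i (V i w).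
  by rewrite /h; case: (fintype.split i) => j //; rewrite le_max lexx.
pose e (i : 'I_(t + t)) : R := match fintype.split i with
  | inl i1 => 1 + 2 * u i1 ^+ 2 | inr i2 => if b i2 then p i2 else 1 - p i2 end.
have el i : e (lshift t i) = 1 + 2 * u i ^+ 2 by rewrite /e (unsplitK (inl i)).
have er i : e (rshift t i) = if b i then p i else 1 - p i by rewrite /e (unsplitK (inr i)).
have WE i : (\int[P]_w (h i (V i w))%:E = (e i)%:E)%E.
  rewrite -(splitK i); case: (fintype.split i) => j /=.
    rewrite el; under eq_integral do rewrite hl /V joint_family_lshift max_r ?q0//.
    have -> : (fun w => (q j (X j.+1 w))%:E) =
        (fun w => ((u j)%:E * (X j.+1 w)%:E + (1 - u j * mean j.+1 + 2 * u j ^+ 2)%:E)%E).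
      by apply/funext => w; rewrite -EFinM -EFinD; congr EFin; rewrite /q; ring.
    have iX : P.-integrable setT (fun w => (X j.+1 w)%:E).
      apply/integrableP; split; first by apply/measurable_EFinP; exact: measurable_X.
      rewrite (eq_integral (fun w => (X j.+1 w)%:E)) ?integral_X ?ltry// => w _.
      by rewrite /= ger0_norm//; case/andP: (X01 _ w (i1t j)).
    rewrite integralD//=; last 2 first.
    - exact: integrableZl.
    - exact: finite_measure_integrable_cst.
    rewrite integralZl// integral_X// integral_cst//.
    have -> : (P : {measure set T -> \bar R}) setT = 1%E by exact: probability_setT.
    rewrite mule1.
    by rewrite -EFinM -EFinD; congr EFin; ring.
  rewrite er -prob_Z_eq1 -[X in P X]setIT -integral_indic//; last first.
    by rewrite -[X in measurable X]setTI; apply: measurable_Z => //; exact: measurable_eq1.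
  by apply: eq_integral => w _; rewrite hr /V joint_family_rshift.
have := integral_prod_independent P _ _ e iW W0 WE.
rewrite [in RHS]big_split_ord/= => HE.
set S := [set w | _]; set K := expR (- (lam * eps)).
have sumE (F : nat -> R) : \sum_(j <- iota 1 t) F j = \sum_(i < t) F i.+1.
  have -> : iota 1 t = index_iota 1 t.+1 by rewrite /index_iota subn1.
  by rewrite big_add1 /= big_mkord.
have mS : measurable S.
  rewrite (_ : S = [set w | pattern_of w = b] `&`
    [set w | eps <= \sum_(j <- iota 1 t) c j * (X j w - mean j)])//.
  apply: measurableI; first exact: measurable_pattern.
  rewrite -[X in measurable X]setTI; apply: measurable_fun_le => //.
  under eq_fun do rewrite sumE.
  apply: measurable_sum => i; apply: measurable_funM => //.
  by apply: measurable_funB => //; exact: measurable_X.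
rewrite -[S]setIT -integral_indic//.
(* Markov's inequality: on [S] the pattern indicators equal 1 and the remaining product is at least
   exp(lam eps), which [K] cancels. *)
apply: (@le_trans _ _ (\int[P]_w (K * \prod_i h i (V i w))%:E)%E).
  apply: ge0_le_integral => //.
  - by apply/measurable_EFinP; exact: measurable_indic.
  - apply/measurable_EFinP; apply: measurable_funM => //.
    by apply: measurable_prod => i _; exact: (iW.1 i).
  move=> w _; rewrite lee_fin indicE; case: (boolP (w \in S)) => [/set_mem[wb weps]|_]; last first.
    by rewrite mulr_ge0 ?expR_ge0//; apply: prodr_ge0.
  rewrite big_split_ord/= [X in _ * (_ * X)]big1 ?mulr1 => [|i _]; last first.
    by rewrite hr /V joint_family_rshift indicE mem_set//= -wb ffunE.
  apply: (@le_trans _ _ (K * expR (\sum_(i < t) u i * (X i.+1 w - mean i.+1)))).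
    rewrite -expRD -[leLHS]expR0 ler_expR.
    under eq_bigr do rewrite -mulrA.
    rewrite -mulr_sumr -(sumE (fun j => c j * (X j w - mean j))).
    by rewrite addrC subr_ge0 ler_wpM2l.
  rewrite ler_wpM2l ?expR_ge0// expR_sum; apply: ler_prod => i _.
  by rewrite expR_ge0 hl /V joint_family_lshift le_max qexp orbT.
under eq_integral do rewrite EFinM.
rewrite ge0_integralZl_EFin ?expR_ge0//; last 2 first.
- by move=> w _; rewrite lee_fin; apply: prodr_ge0.
- by apply/measurable_EFinP; apply: measurable_prod => i _; exact: (iW.1 i).
rewrite HE -EFinM lee_fin (eq_bigr (fun i => 1 + 2 * u i ^+ 2)) => [|i _]; last exact: el.
rewrite [X in _ * (_ * X)](eq_bigr (fun i => if b i then p i else 1 - p i)) => [|i _]; last exact: er.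
rewrite -/(pattern_weight p b) expRD -/K [leRHS]mulrC -[leRHS]mulrA.
have w0 : 0 <= pattern_weight p b.
  apply: prodr_ge0 => i _; rewrite -lee_fin.
  by have := prob_Z_eq1 i (b i); case: (b i) => <-.
rewrite ler_wpM2l ?expR_ge0// ler_wpM2r// sumE mulr_sumr expR_sum.
apply: ler_prod => i _; apply/andP; split; first by rewrite addr_ge0// mulr_ge0// sqr_ge0.
by apply: le_trans (expR_ge1Dx _); rewrite /u exprMn mulrA.
Qed.

End selection_patterns.

(** * The probability bound at a fixed horizon *)

Section pattern_times.
Context {t : nat}.
Implicit Types b : {ffun 'I_t -> bool}.

(** Time [j] is coordinate [j.-1], and times beyond [t] count as not selected. Time 0 would share
    the coordinate of time 1, but only lists starting at 1 or later are filtered. *)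
Definition pattern_mem b (j : nat) : bool := oapp b false (insub j.-1).

Definition pattern_times b : seq nat := [seq j <- iota 1 t | pattern_mem b j].

Lemma pattern_memS b (i : 'I_t) : pattern_mem b i.+1 = b i.
Proof. by rewrite /pattern_mem /= valK. Qed.

Lemma size_pattern_times_iota b s n : (0 < s)%N -> (s + n <= t.+1)%N ->
  size [seq j <- iota s n | pattern_mem b j] =
  #|[pred i : 'I_t | b i & (s <= i.+1 < s + n)%N]|.
Proof.
move=> s0 sn; pose q j := pattern_mem b j && (s <= j < s + n)%N.
have -> : #|[pred i : 'I_t | b i & (s <= i.+1 < s + n)%N]| = count q (iota 1 t).
  rewrite -sum1_count -sum1_card.
  have -> : iota 1 t = index_iota 1 t.+1 by rewrite /index_iota subn1.
  rewrite big_add1 /= big_mkord; apply: eq_bigl => i.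
  by rewrite /q pattern_memS !inE.
rewrite -size_filter (filter_iota_split q t s n s0 sn) !size_cat.
rewrite (_ : [seq j <- iota 1 s.-1 | q j] = [::]); last first.
  apply/eqP; rewrite -size_eq0 size_filter -leqn0 leqNgt -has_count; apply/hasPn => j.
  by rewrite mem_iota /q => jr; apply/negP => /andP[_]; lia.
rewrite (_ : [seq j <- iota (s + n) _ | q j] = [::]); last first.
  apply/eqP; rewrite -size_eq0 size_filter -leqn0 leqNgt -has_count; apply/hasPn => j.
  by rewrite mem_iota /q => jr; apply/negP => /andP[_]; lia.
rewrite addn0; congr size; apply: eq_in_filter => j; rewrite mem_iota /q => ->.
by rewrite andbT.
Qed.

Lemma size_pattern_times b : size (pattern_times b) = #|[pred i | b i]|.
Proof.
rewrite size_pattern_times_iota//; apply: eq_card => i; rewrite !inE.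
by rewrite /= add1n ltnS ltn_ord andbT.
Qed.

Lemma Eset_pattern (d : measure_display) (T : measurableType d) (R : realType) (Z : nat -> T -> R) w :
  Eset Z t w = pattern_times (pattern_of t Z w).
Proof.
apply: eq_in_filter => -[|j]; rewrite mem_iota// add1n => /andP[_]; rewrite ltnS => jt.
by rewrite -[j]/(val (Ordinal jt)) pattern_memS ffunE.
Qed.

End pattern_times.

Section union_bound.
Context {d : measure_display} {T : measurableType d} {R : realType}.
Variable P : probability T R.

Lemma union_bound (I : choiceType) (r : seq I) (A : I -> set T) (S : set T) :
  measurable S -> (forall i, measurable (A i)) ->
  (forall w, S w -> exists2 i, i \in r & A i w) ->
  (P S <= \sum_(i <- r) P (A i))%E.
Proof.
move=> mS mA SA; apply: (@le_trans _ _ (P (\big[setU/set0]_(i <- r) A i))).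
  apply: le_measure; rewrite ?inE//; first exact: bigsetU_measurable.
  by move=> w /SA[i ir Aw]; rewrite -bigcup_seq; exists i.
elim: r {SA} => [|i r IH]; first by rewrite !big_nil measure0.
rewrite !big_cons; apply: le_trans (measureU2 _ _ _) _ => //.
  exact: bigsetU_measurable.
exact: leeD2l.
Qed.

End union_bound.

(** * Deviations, good patterns and the union over patterns *)

Section fixed_horizon.
Context {d : measure_display} {T : measurableType d} {R : realType}.
Variables (P : probability T R) (t : nat) (X Z : nat -> T -> R) (p : 'I_t -> R).
Hypothesis indep : mutually_independent P (joint_family t X Z).
Hypothesis X01 : forall j w, (1 <= j <= t)%N -> 0 <= X j w <= 1.
Hypothesis PZ : forall i : 'I_t, P [set w | Z i.+1 w = 1] = (p i)%:E.
Hypothesis p01 : forall i, 0 <= p i <= 1.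

Let mean j := fine 'E_P[X j].

Lemma pattern_times_bounds (b : {ffun 'I_t -> bool}) j : j \in pattern_times b -> (1 <= j <= t)%N.
Proof. by rewrite mem_filter mem_iota add1n => /andP[_] /andP[-> +]; rewrite ltnS. Qed.

Lemma ewma_measurable (b : {ffun 'I_t -> bool}) delta l : (l <= size (pattern_times b))%N ->
  measurable_fun setT (fun w => ewma delta (pattern_times b) (X ^~ w) l).
Proof.
elim: l => [_|l IH le]/=; first exact: measurable_cst.
apply: measurable_funD; apply: measurable_funM => //.
- exact: IH (ltnW le).
- by apply: (measurable_X P t X Z indep); apply: pattern_times_bounds (mem_nth _ le).
Qed.

Lemma prob_pattern_le (b : {ffun 'I_t -> bool}) :
  (P [set w | pattern_of t Z w = b] <= (pattern_weight p b)%:E)%E.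
Proof.
(* The exponential bound with all weights and the exponent equal to zero. *)
have l0 (j : nat) : `|0 * 0 : R| <= 2^-1 by rewrite mulr0 normr0 invr_ge0.
have := pattern_hoeffding P t X Z p indep X01 PZ b (fun=> 0) 0 0 (lexx _) l0.
rewrite mul0r oppr0 add0r expr0n/= mulr0 mul0r expR0 mulr1; apply: le_trans.
rewrite (_ : [set w | _ /\ _] = [set w | pattern_of t Z w = b])//.
apply/seteqP; split=> [w []//|w wb]; split=> //.
by rewrite big1// => j _; rewrite mul0r.
Qed.

(** The exponential bound is applied to the weights from [ewma_weights] and to their negatives, one
    for each sign of the deviation; hence the factor 2. *)
Lemma ewma_deviation (b : {ffun 'I_t -> bool}) (delta eps : R) l :
  0 < delta <= 1 -> 0 < eps <= 2 -> (0 < l <= size (pattern_times b))%N ->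
  (P [set w | pattern_of t Z w = b /\
     (eps <= `|ewma delta (pattern_times b) (X ^~ w) l -
               ewma delta (pattern_times b) mean l|)%R] <=
   (pattern_weight p b * (2 * expR (- (eps ^+ 2 * l%:R `^ delta / 8))))%:E)%E.
Proof.
move=> d01 /andP[eps0 eps2] lb.
have ub : uniq (pattern_times b) by rewrite filter_uniq// iota_uniq.
have sb : {subset pattern_times b <= iota 1 t} by move=> j; rewrite mem_filter => /andP[].
have [c [cE cb c2]] := @ewma_weights R delta _ _ l d01 (iota_uniq 1 t) ub sb lb.
have l0 : 0 < l%:R :> R by rewrite ltr0n; case/andP: lb.
have ld0 : 0 < l%:R `^ delta :> R by exact: powR_gt0.
(* Then lam times the largest weight is eps/4 <= 1/2, as required, and the quadratic term is half of
   lam eps, leaving -lam eps/2 = -eps^2 l^delta / 8. *)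
pose lam := eps * l%:R `^ delta / 4.
have lam0 : 0 <= lam by rewrite /lam !mulr_ge0// ltW.
have lamq : lam * l%:R `^ (- delta) = eps / 4.
  by rewrite /lam powRN; field; rewrite gt_eqF.
have lamc j : `|lam * c j| <= 2^-1.
  have /andP[c0 c1] := cb j; rewrite ger0_norm; last exact: mulr_ge0.
  by apply: (@le_trans _ _ (eps / 4)); [rewrite -lamq ler_wpM2l | lra].
have lamNc : forall i, `|lam * - c i| <= 2^-1 by move=> i; rewrite mulrN normrN; exact: lamc.
have bound : - (lam * eps) + 2 * lam ^+ 2 * (\sum_(j <- iota 1 t) c j ^+ 2) <=
    - (eps ^+ 2 * l%:R `^ delta / 8).
  apply: (@le_trans _ _ (- (lam * eps) + 2 * lam ^+ 2 * l%:R `^ (- delta))).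
    by rewrite lerD2l ler_wpM2l// mulr_ge0// sqr_ge0.
  have -> : 2 * lam ^+ 2 * l%:R `^ (- delta) = 2 * lam * (lam * l%:R `^ (- delta)) by ring.
  by rewrite lamq /lam le_eqVlt; apply/orP; left; apply/eqP; field.
have H1 := pattern_hoeffding P t X Z p indep X01 PZ b c eps lam lam0 lamc.
have H2 := pattern_hoeffding P t X Z p indep X01 PZ b (fun j => - c j) eps lam lam0 lamNc.
have E w : ewma delta (pattern_times b) (X ^~ w) l -
    ewma delta (pattern_times b) mean l = \sum_(j <- iota 1 t) c j * (X j w - mean j).
  by rewrite -ewma_sub cE.
have NE w : \sum_(j <- iota 1 t) - c j * (X j w - mean j) =
    - \sum_(j <- iota 1 t) c j * (X j w - mean j).
  by rewrite -sumrN; apply: eq_bigr => j _; rewrite mulNr.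
have mD : measurable_fun setT (fun w => ewma delta (pattern_times b) (X ^~ w) l -
    ewma delta (pattern_times b) mean l).
  by apply: measurable_funB => //; apply: ewma_measurable; case/andP: lb.
have mS (f : T -> R) : measurable_fun setT f ->
    measurable [set w | pattern_of t Z w = b /\ eps <= f w].
  move=> mf; apply: (measurableI [set w | pattern_of t Z w = b] [set w | eps <= f w]).
    exact: (measurable_pattern P t X Z indep).
  by rewrite -[X in measurable X]setTI; apply: measurable_fun_le.
pose g (s : bool) w := (-1) ^+ s * (ewma delta (pattern_times b) (X ^~ w) l -
    ewma delta (pattern_times b) mean l).
have mg s : measurable_fun setT (g s) by apply: measurable_funM.
apply: (le_trans (union_bound P _ [:: false; true]
  (fun s => [set w | pattern_of t Z w = b /\ eps <= g s w]) _ _ _ _)).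
- by apply: mS; exact: measurableT_comp.
- by move=> s; exact: mS.
- move=> w [wb]; rewrite ler_normr => /orP[h|h]; [exists false|exists true] => //; split => //.
    by rewrite /g expr0 mul1r.
  by rewrite /g expr1 mulN1r.
have w0 := pattern_weight_ge0 p b p01.
set V := - (lam * eps) + _ in H1 bound *.
have W : pattern_weight p b * expR V <= pattern_weight p b * expR (- (eps ^+ 2 * l%:R `^ delta / 8)).
  by rewrite ler_wpM2l// ler_expR.
rewrite big_cons big_seq1 mulrCA -[2]/(1 + 1) mulrDl mul1r EFinD; apply: leeD.
  apply: le_trans (_ : _ <= (pattern_weight p b * expR V)%:E)%E _; last by rewrite lee_fin.
  by under eq_set do rewrite /g expr0 mul1r E.
apply: le_trans (_ : _ <= (pattern_weight p b * expR V)%:E)%E _; last by rewrite lee_fin.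
under eq_set do rewrite /g expr1 mulN1r E -NE.
by move: H2; under [X in expR (_ + _ * X)]eq_bigr do rewrite sqrrN.
Qed.

Variables (beta gamma delta b0 eps Q mu : R) (n M : nat) (s : nat -> nat) (m : nat -> R).
Hypotheses (d01 : 0 < delta <= 1) (eps02 : 0 < eps <= 2).
Hypotheses (mu0 : 0 < mu) (Q0 : 0 < Q) (QE : Q = t%:R `^ (1 - beta) / (1 - beta)).
Hypothesis pQ : \sum_i p i <= Q.
Hypothesis pmu : forall a, (0 < a)%N -> (a + n <= t.+1)%N ->
  mu <= \sum_(i < t | (a <= i.+1 < a + n)%N) p i.
Hypothesis n_le : n%:R <= t%:R `^ gamma :> R.
Hypothesis forget : expR (- (mu / 4 * (4 * Q) `^ (- delta))) <= eps.
Hypothesis epoch_itv : forall k, (1 <= k)%N -> (k <= M - 1)%N ->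
  [/\ (0 < s k)%N, (s k + n <= s k.+1)%N & (s k.+1 <= t)%N].
Hypothesis epoch_mean : forall k j, (1 <= k)%N -> (k <= M - 1)%N ->
  (s k <= j < s k.+1)%N -> mean j = m k.
Hypothesis epoch_eps : forall k, (1 <= k)%N -> (k <= M - 1)%N ->
  2 * eps <= m k / t%:R `^ b0.

(** Windows of length [n] are controlled at every starting time [a.+1], so the notion does not refer
    to the epochs; the price is a factor [t] in the probability. *)
Definition good_pattern (b : {ffun 'I_t -> bool}) :=
  ((size (pattern_times b))%:R <= 4 * Q) &&
  [forall a : 'I_t, (a.+1 + n <= t.+1)%N ==>
     (mu / 4 <= (size [seq j <- iota a.+1 n | pattern_mem b j])%:R)].

Lemma bad_pattern_weight :
  \sum_(b | ~~ good_pattern b) pattern_weight p b <=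
  expR (- Q) + t%:R * expR (- (mu / 4)).
Proof.
pose A (a : 'I_t) (b : {ffun 'I_t -> bool}) := (a.+1 + n <= t.+1)%N &&
  (#|[pred i : 'I_t | b i & (a.+1 <= i.+1 < a.+1 + n)%N]|%:R < mu / 4).
apply: (@le_trans _ _ (\sum_(b : {ffun 'I_t -> bool} | 4 * Q < #|[pred i | b i]|%:R) pattern_weight p b +
  \sum_(a < t) \sum_(b | A a b) pattern_weight p b)).
  rewrite [X in _ <= _ + X](exchange_big_dep xpredT)//= [leLHS]big_mkcond.
  rewrite [X in _ <= X + _]big_mkcond -big_split/=.
  apply: ler_sum => b _; have w0 := pattern_weight_ge0 p b p01.
  have S0 (q : pred 'I_t) : 0 <= \sum_(a < t | q a) pattern_weight p b by apply: sumr_ge0.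
  case: ifPn => [|_]; last by rewrite addr_ge0//; case: ifP.
  rewrite /good_pattern negb_and -ltNge size_pattern_times => /orP[->|].
    by rewrite lerDl.
  rewrite negb_forall => /existsP[a]; rewrite negb_imply -ltNge => /andP[an].
  rewrite size_pattern_times_iota// => h.
  have Aab : A a b by rewrite /A an.
  rewrite (bigD1 a)//=; apply: ler_wpDl; first by case: ifP.
  exact: ler_wpDr.
apply: lerD; first exact: pattern_upper_tail.
have -> : t%:R * expR (- (mu / 4)) = \sum_(a < t) expR (- (mu / 4)).
  by rewrite sumr_const card_ord mulr_natl.
apply: ler_sum => a _; have [an|an] := leqP (a.+1 + n) t.+1; last first.
  by rewrite big_pred0 ?expR_ge0// => b; rewrite /A leqNgt an.
apply: le_trans (pattern_lower_tail p _ _ p01 (pmu a.+1 isT an)).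
by rewrite le_eqVlt; apply/orP; left; apply/eqP; apply: eq_bigl => b; rewrite /A an.
Qed.

(** Noise and bias are each at most [eps], and [2 * eps] is within the tolerance. The bias is
    contracted at the positions from [a], the number of selected times before the epoch, up to
    [l]. *)
Lemma good_pattern_Egood w (b := pattern_of t Z w) : good_pattern b ->
  (forall l, (0 < l <= size (pattern_times b))%N -> mu / 4 <= l%:R ->
    `|ewma delta (pattern_times b) (X ^~ w) l - ewma delta (pattern_times b) mean l| < eps) ->
  Egood beta gamma delta b0 X Z t M s m w.
Proof.
move=> /andP[bQ /forallP bn] dev; split.
  by rewrite Eset_pattern -mulrA -QE.
move=> k l k1 kM l1; rewrite /Tsel Yseq_ewma Eset_pattern -/b => lb slow lhi.
have [sk0 skn skt] := epoch_itv k k1 kM.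
set e := pattern_times b in lb slow lhi *.
have skn' : (s k + n <= nth 0%N e l.-1)%N.
  by rewrite -(ler_nat R) natrD; apply: le_trans slow; rewrite lerD2l.
have sknt : (s k + n <= t.+1)%N by lia.
pose a := size [seq j <- iota 1 (s k).-1 | pattern_mem b j].
have al := nth_filter_iota_count (pattern_mem b) t (s k) n sk0 sknt l.-1 skn'.
rewrite -/a in al.
set c := size [seq j <- iota (s k) n | pattern_mem b j] in al.
have cmu : mu / 4 <= c%:R.
  have skt' : ((s k).-1 < t)%N by lia.
  have := bn (Ordinal skt'); rewrite /= prednK// sknt/=.
  by [].
have acl : (a + c <= l)%N := leq_trans al (leq_pred l).
have al0 : (a <= l)%N := leq_trans (leq_addr c a) acl.
have le1 : (l.-1 < size e)%N by rewrite prednK.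
have means i : (a <= i < l)%N -> mean (nth 0%N e i) = m k.
  move=> /andP[ai il]; apply: epoch_mean => //.
  rewrite (nth_filter_iota_ge (pattern_mem b) t (s k) n)//=; last first.
    by rewrite -/a ai /=; apply: leq_trans lb.
  apply: leq_ltn_trans lhi; apply: (nth_filter_iota_mono (pattern_mem b) t).
  by apply/andP; split; [by rewrite -ltnS prednK | exact: le1].
have d0 : 0 <= delta by case/andP: d01 => /ltW.
have mean01 j : j \in e -> 0 <= mean j <= 1.
  by move=> /pattern_times_bounds; exact: (mean_itv P t X Z indep X01).
have mk01 : 0 <= m k <= 1.
  rewrite -(means l.-1); [by apply: mean01; exact: mem_nth | ].
  by rewrite (leq_trans (leq_addr c a) al) prednK /=.
(* Whatever the earlier epochs did, both numbers lie in [0,1], so the contraction starts from an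
   error of at most 1. *)
have ya : `|ewma delta e mean a - m k| <= 1.
  have /andP[y0 y1] : 0 <= ewma delta e mean a <= 1 by apply: ewma_itv => //; exact: leq_trans al0 lb.
  by case/andP: mk01 => m0 m1; rewrite ler_norml; lra.
have al' : (a + (l - a) = l)%N by exact: subnKC.
have := @ewma_contract R delta e mean (m k) a (l - a) l d0.
rewrite al' => /(_ (leqnn _) means ya) contract.
have lc : mu / 4 <= (l - a)%:R.
  by apply: le_trans cmu _; rewrite ler_nat leq_subRL.
have ll : mu / 4 <= l%:R by apply: le_trans lc _; rewrite ler_nat leq_subr.
have l0 : (0 : R) < l%:R by rewrite ltr0n.
have {}contract : `|ewma delta e mean l - m k| <= eps.
  (* There are at least mu/4 contraction steps, and each has rate at least (4Q)^(-delta), because l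
     is at most the number of selected times. *)
  apply: le_trans contract _; apply: le_trans forget; rewrite ler_expR lerN2.
  apply: ler_pM => //; [by rewrite divr_ge0// ltW | exact: powR_ge0 | ].
  rewrite !powRN lef_pV2 ?posrE ?powR_gt0 ?mulr_gt0//.
  rewrite ge0_ler_powR// ?nnegrE ?ler0n ?mulr_ge0// ?(ltW Q0)//.
  by apply: le_trans bQ; rewrite ler_nat.
apply: le_trans (epoch_eps k k1 kM).
have -> : ewma delta e (X ^~ w) l - m k = (ewma delta e (X ^~ w) l - ewma delta e mean l) +
   (ewma delta e mean l - m k) by ring.
apply: le_trans (ler_normD _ _) _.
have := dev l _ ll; rewrite l1 lb => /(_ isT) dv.
by rewrite -/e in dv; lra.
Qed.

(** On each of the finitely many patterns the selected times are deterministic, and the event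
    becomes a countable intersection of inequalities between measurable functions. *)
Lemma measurable_Egood : measurable (Egood beta gamma delta b0 X Z t M s m).
Proof.
pose G (b : {ffun 'I_t -> bool}) :=
  [set _ : T | (size (pattern_times b))%:R <= 4 * (t%:R `^ (1 - beta)) / (1 - beta)] `&`
  [set w | (forall k l : nat, (1 <= k)%N -> (k <= M - 1)%N ->
       (1 <= l)%N -> (l <= size (pattern_times b))%N ->
       (s k)%:R + t%:R `^ gamma <= (nth 0%N (pattern_times b) l.-1)%:R :> R ->
       (nth 0%N (pattern_times b) l.-1 < s k.+1)%N ->
       `|ewma delta (pattern_times b) (X ^~ w) l - m k| <= m k / t%:R `^ b0)].
have mG b : measurable (G b).
  have mcond (A : Prop) (B : set T) : (A -> measurable B) -> measurable [set w | A -> B w].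
    move=> AB; have [HA|HA] := pselect A.
      rewrite (_ : mkset _ = B); first exact: AB.
      by apply/seteqP; split=> w //=; apply.
    by rewrite (_ : mkset _ = setT)//; apply/seteqP; split=> // w _ /HA.
  apply: measurableI.
    case: (_ <= _); first by rewrite (_ : mkset _ = setT)//; apply/seteqP; split.
    by rewrite (_ : mkset _ = set0)//; apply/seteqP; split.
  rewrite (_ : mkset _ = \bigcap_k \bigcap_l [set w | (1 <= k)%N -> (k <= M - 1)%N ->
       (1 <= l)%N -> (l <= size (pattern_times b))%N ->
       (s k)%:R + t%:R `^ gamma <= (nth 0%N (pattern_times b) l.-1)%:R :> R ->
       (nth 0%N (pattern_times b) l.-1 < s k.+1)%N ->
       `|ewma delta (pattern_times b) (X ^~ w) l - m k| <= m k / t%:R `^ b0]); last first.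
    by apply/seteqP; split=> w h => [k _ l _|k l]; [exact: h | exact: (h k I l I)].
  apply: bigcapT_measurable => k; apply: bigcapT_measurable => l.
  apply: (mcond) => _; apply: (mcond) => _; apply: (mcond) => _.
  apply: (mcond) => lb; apply: (mcond) => _; apply: (mcond) => _.
  rewrite -[X in measurable X]setTI; apply: measurable_fun_le => //.
  apply: measurableT_comp => //; apply: measurable_funB => //.
  exact: ewma_measurable.
rewrite (_ : Egood _ _ _ _ _ _ _ _ _ _ =
  \bigcup_(b in [set: {ffun 'I_t -> bool}]) ([set w | pattern_of t Z w = b] `&` G b)).
  apply: fin_bigcup_measurable => // b _; apply: measurableI => //.
  exact: (measurable_pattern P t X Z indep).
have GE w : Egood beta gamma delta b0 X Z t M s m w <-> G (pattern_of t Z w) w.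
  rewrite /Egood /G /= /Tsel Eset_pattern.
  by split=> -[h1 h2]; split=> // k l; have := h2 k l; rewrite Yseq_ewma Eset_pattern.
apply/seteqP; split=> [w /GE h|w [b _ [/= <- /GE]]//].
by exists (pattern_of t Z w).
Qed.

Lemma Egood_prob_ge :
  ((1 - (expR (- Q) + t%:R * expR (- (mu / 4)) +
      t%:R * (2 * expR (- (eps ^+ 2 * (mu / 4) `^ delta / 8)))))%:E <=
   P (Egood beta gamma delta b0 X Z t M s m))%E.
Proof.
set E := Egood _ _ _ _ _ _ _ _ _ _.
have mE : measurable E := measurable_Egood.
have mpat b := measurable_pattern P t X Z indep b.
set K := t%:R * (2 * _).
have K0 : 0 <= K by rewrite !mulr_ge0// expR_ge0.
suff H : (P (~` E) <= (expR (- Q) + t%:R * expR (- (mu / 4)) + K)%:E)%E.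
  have := probability_setC P (measurableC mE); rewrite setCK => ->.
  have : P (~` E) \is a fin_num by rewrite fin_num_measure//; exact: measurableC.
  move: H; case: (P (~` E)) => // r; rewrite -EFinB !lee_fin; lra.
apply: (le_trans (union_bound P _ (index_enum {ffun 'I_t -> bool})
  (fun b => ~` E `&` [set w | pattern_of t Z w = b]) _ _ _ _)).
- exact: measurableC.
- by move=> b; apply: measurableI => //; exact: measurableC.
- by move=> w Ew; exists (pattern_of t Z w) => //; rewrite mem_index_enum.
(* A bad pattern is charged its whole weight; under a good one, failure forces a deviation at one of
   at most [t] indices, which costs a factor [K]. *)
apply: (@le_trans _ _ (\sum_b (if good_pattern b then pattern_weight p b * K else pattern_weight p b))%:E).
  rewrite -sumEFin; apply: lee_sum => b _; case: ifPn => [gb|_]; last first.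
    apply: le_trans (prob_pattern_le b); apply: le_measure; rewrite ?inE//.
    by apply: measurableI => //; exact: measurableC.
  pose A (l : nat) := [set w | (pattern_of t Z w = b /\
     (eps <= `|ewma delta (pattern_times b) (X ^~ w) l -
               ewma delta (pattern_times b) mean l|))
     /\ ((0 < l <= size (pattern_times b))%N /\ mu / 4 <= l%:R)].
  have mA l : measurable (A l).
    have [lb|lb] := boolP (0 < l <= size (pattern_times b))%N; last first.
      by rewrite (_ : A l = set0)//; apply/seteqP; split=> // w [_ []]; rewrite (negbTE lb).
    have [lm|lm] := boolP (mu / 4 <= l%:R); last first.
      by rewrite (_ : A l = set0)//; apply/seteqP; split=> // w [_ []]; rewrite (negbTE lm).
    rewrite (_ : A l = [set w | pattern_of t Z w = b] `&`
      [set w | eps <= `|ewma delta (pattern_times b) (X ^~ w) l -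
               ewma delta (pattern_times b) mean l|]).
      apply: measurableI => //; rewrite -[X in measurable X]setTI.
      apply: measurable_fun_le => //; apply: measurableT_comp => //.
      apply: measurable_funB => //; apply: ewma_measurable.
      by case/andP: lb.
    by apply/seteqP; split=> w; [case | split].
  apply: (le_trans (union_bound P _ (iota 1 t) A _ _ _ _)).
  - by apply: measurableI => //; exact: measurableC.
  - by [].
  - move=> w [nEw wb]; apply: contrapT => nA; apply: nEw.
    apply: good_pattern_Egood; rewrite wb// => l lb lm.
    rewrite ltNge; apply/negP => h; apply: nA; exists l; last by [].
    rewrite mem_iota add1n ltnS; case/andP: lb => -> lb /=.
    apply: leq_trans lb _; rewrite size_filter.
    by apply: leq_trans (count_size _ _) _; rewrite size_iota.
  have -> : pattern_weight p b * K = \sum_(l <- iota 1 t)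
      pattern_weight p b * (2 * expR (- (eps ^+ 2 * (mu / 4) `^ delta / 8))).
    by rewrite big_const_seq count_predT size_iota iter_addr_0 -[RHS]mulr_natl /K mulrCA.
  rewrite -sumEFin; apply: lee_sum => l _.
  have w0 := pattern_weight_ge0 p b p01.
  have [[lb lm]|nl] := pselect ((0 < l <= size (pattern_times b))%N /\ mu / 4 <= l%:R); last first.
    rewrite (_ : A l = set0) ?measure0 ?lee_fin ?mulr_ge0 ?expR_ge0//.
    by apply/seteqP; split=> // w [_ /nl].
  apply: (@le_trans _ _ (pattern_weight p b * (2 * expR (- (eps ^+ 2 * l%:R `^ delta / 8))))%:E).
    rewrite (_ : A l = [set w | pattern_of t Z w = b /\
     eps <= `|ewma delta (pattern_times b) (X ^~ w) l - ewma delta (pattern_times b) mean l|]).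
      exact: ewma_deviation.
    by apply/seteqP; split=> w; [case | split].
  rewrite lee_fin ler_wpM2l// ler_wpM2l// ler_expR lerN2 ler_wpM2r// ler_wpM2l ?sqr_ge0//.
  case/andP: d01 => d0 _.
  by rewrite ge0_ler_powR// ?nnegrE ?divr_ge0 ?(ltW mu0) ?(ltW d0).
rewrite lee_fin; apply: (@le_trans _ _ (\sum_(b | ~~ good_pattern b) pattern_weight p b +
   \sum_b pattern_weight p b * K)).
  rewrite [X in X + _]big_mkcond -big_split/=; apply: ler_sum => b _.
  have w0 := pattern_weight_ge0 p b p01.
  by case: (good_pattern b) => /=; rewrite ?add0r// lerDl mulr_ge0.
by rewrite lerD ?bad_pattern_weight// -mulr_suml sum_pattern_weight mul1r.
Qed.

End fixed_horizon.

(** * Asymptotics *)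

Section asymptotics.
Context {R : realType}.
Implicit Types (a p u : R).

(** With v = ln u, the tangent to exp at a v lies below exp at the points v and 0; averaging with
    weights a and 1 - a cancels the linear terms. *)
Lemma powR_bernoulli u a : 0 <= u -> 0 < a <= 1 -> u `^ a <= 1 + a * (u - 1).
Proof.
move=> u0 /andP[a0 a1]; have [->|uN0] := eqVneq u 0.
  by rewrite powR0 ?gt_eqF//; lra.
have up : 0 < u by rewrite lt_neqAle eq_sym uN0.
rewrite /powR (negbTE uN0) -{2}(lnK up); move: (ln u) => v.
have e0 := expR_gt0 (a * v).
have h1 := expR_ge1Dx ((1 - a) * v); have h2 := expR_ge1Dx (- (a * v)).
have E1 : expR v = expR (a * v) * expR ((1 - a) * v) by rewrite -expRD; congr expR; ring.
have E2 : 1 = expR (a * v) * expR (- (a * v)) by rewrite -expRD subrr expR0.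
have k1 : expR (a * v) * (1 + (1 - a) * v) <= expR v by rewrite E1 ler_pM2l.
have k2 : expR (a * v) * (1 - a * v) <= 1 by rewrite [leRHS]E2 ler_pM2l.
have := ler_wpM2l (ltW a0) k1; have a1' : 0 <= 1 - a by lra.
have := ler_wpM2l a1' k2; lra.
Qed.

(** Each term is at most the increment of the right-hand side, by [powR_bernoulli] at u =
    t/(t+1). *)
Lemma sum_natr_powRN_le beta t : 0 <= beta < 1 ->
  \sum_(i < t) (i.+1%:R : R) `^ (- beta) <= t%:R `^ (1 - beta) / (1 - beta).
Proof.
move=> /andP[b0 b1]; have b1' : 0 < 1 - beta by rewrite subr_gt0.
elim: t => [|t IH]; first by rewrite big_ord0 divr_ge0 ?powR_ge0// ltW.
rewrite big_ord_recr/=; apply: le_trans (lerD IH (lexx _)) _.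
have N0 : 0 < t.+1%:R :> R by rewrite ltr0n.
have E : t%:R `^ (1 - beta) = t.+1%:R `^ (1 - beta) * (t%:R / t.+1%:R) `^ (1 - beta) :> R.
  by rewrite -powRM ?divr_ge0// mulrCA divff ?mulr1// gt_eqF.
have := @powR_bernoulli (t%:R / t.+1%:R) (1 - beta).
rewrite divr_ge0//= b1' /= => /(_ isT); rewrite gerBl b0 => /(_ isT) B.
have EN : t.+1%:R `^ (- beta) = t.+1%:R `^ (1 - beta) / t.+1%:R :> R.
  by rewrite powRB ?gt_eqF ?implybT// powRr1// mulrAC divff ?mul1r ?powRN// gt_eqF.
have Nb0 : 0 < t.+1%:R `^ (1 - beta) :> R by exact: powR_gt0.
have H : t%:R `^ (1 - beta) <= t.+1%:R `^ (1 - beta) - (1 - beta) * t.+1%:R `^ (- beta) :> R.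
  rewrite E EN; apply: (@le_trans _ _ (t.+1%:R `^ (1 - beta) * (1 + (1 - beta) * (t%:R / t.+1%:R - 1)))).
    by rewrite ler_pM2l.
  rewrite le_eqVlt; apply/orP; left; apply/eqP; rewrite -(natr1 t); field.
  by rewrite natr1 gt_eqF.
by rewrite ler_pdivlMr// mulrDl divfK ?gt_eqF//; lra.
Qed.

Lemma near_le_natr_powR p (K : R) : 0 < p -> \forall t \near \oo, K <= t%:R `^ p.
Proof.
move=> p0; pose x := (`|K| `^ p^-1); have [N NE] : exists N : nat, x <= N%:R.
  by exists (Num.truncn x).+1; apply: ltW; case/andP: (truncn_itv (powR_ge0 `|K| p^-1)).
exists N => // t /= Nt; apply: le_trans (ler_norm K) _.
have -> : `|K| = x `^ p by rewrite /x -powRrM mulVf ?gt_eqF// powRr1.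
rewrite ge0_ler_powR ?(ltW p0)// ?nnegrE ?powR_ge0//.
by apply: le_trans NE _; rewrite ler_nat.
Qed.

Lemma natr_powR_le_expR t b p : (0 < t)%N -> 0 <= b -> 0 < p ->
  (t%:R : R) `^ b <= expR (b / p * t%:R `^ p).
Proof.
move=> t0 b0 p0; have t0' : 0 < t%:R :> R by rewrite ltr0n.
rewrite {1}/powR gt_eqF// ler_expR -mulrA ler_wpM2l//.
rewrite mulrC ler_pdivlMr// mulrC.
have := expR_ge1Dx (p * ln t%:R : R); rewrite /powR gt_eqF//; lra.
Qed.

(** With T = t^(p/2) the left side is at most exp(A + B T), where B = b/(p/2), and A + B T <= c T^2
    once T >= 1 and T >= (A + B)/c. *)
Lemma near_natr_powR_le_expR (A b c p : R) : 0 <= A -> 0 <= b -> 0 < c -> 0 < p ->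
  \forall t \near \oo, A * t%:R `^ b <= expR (c * t%:R `^ p).
Proof.
move=> A0 b0 c0 p0; have p20 : 0 < p / 2 by rewrite divr_gt0.
have h0 : 0 <= b / (p / 2) by rewrite divr_ge0// ltW.
near=> t.
have t0 : (0 < t)%N by near: t; exists 1%N.
have T1 : 1 <= t%:R `^ (p / 2) :> R by near: t; exact: near_le_natr_powR.
have T2 : (A + b / (p / 2)) / c <= t%:R `^ (p / 2) by near: t; exact: near_le_natr_powR.
have TE : (t%:R : R) `^ p = t%:R `^ (p / 2) * t%:R `^ (p / 2).
  by rewrite -powRD ?pnatr_eq0 ?gtn_eqF ?implybT//; congr powR; field.
apply: (@le_trans _ _ (expR A * expR (b / (p / 2) * t%:R `^ (p / 2)))).
  apply: ler_pM => //.
    by apply: le_trans (expR_ge1Dx _); rewrite lerDr.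
  exact: natr_powR_le_expR.
rewrite -expRD ler_expR TE; move: T1 T2; set T := t%:R `^ (p / 2).
rewrite ler_pdivrMr// => T1 T2; set B := b / (p / 2) in h0 T2 *.
nra.
Unshelve. all: by end_near.
Qed.

End asymptotics.

Theorem theorem1 (R : realType) (gamma0 mu0 beta gamma delta : R) :
  0 < gamma0 -> gamma0 <= 1 -> 0 < mu0 ->
  0 < beta -> beta < gamma -> gamma < gamma0 ->
  0 < delta -> delta < (gamma - beta) / (1 - beta) ->
  exists b theta : R, 0 < b /\ 0 < theta /\
  exists t0 : nat, forall t : nat, (1 <= t)%N -> (t0 <= t)%N ->
  forall (d : measure_display) (T : measurableType d) (P : probability T R)
         (X Z : nat -> T -> R) (M : nat) (s : nat -> nat) (m : nat -> R),
    mutually_independent P (joint_family t X Z) ->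
    (forall j w, (1 <= j <= t)%N -> 0 <= X j w <= 1) ->
    (forall j, (1 <= j <= t)%N ->
       P [set w | Z j w = 1] = ((j%:R) `^ (- beta))%:E /\
       P [set w | Z j w = 0] = (1 - (j%:R) `^ (- beta))%:E) ->
    (1 <= M)%N -> s 1%N = 1%N -> s M = t ->
    (forall k, (1 <= k)%N -> (k < M)%N -> (s k < s k.+1)%N) ->
    (forall k j, (1 <= k)%N -> (k <= M - 1)%N -> (s k <= j < s k.+1)%N ->
       ('E_P[X j] = (m k)%:E)%E) ->
    (forall k, (1 <= k)%N -> (k <= M - 1)%N ->
       t%:R `^ gamma0 <= (s k.+1 - s k)%:R /\ mu0 <= m k) ->
    ((1 - expR (- (t%:R `^ theta)))%:E <= P (Egood beta gamma delta b X Z t M s m))%E.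
Proof.
move=> g00 g01 mu00 b0 bg gg0 d0 dlt.
have b1 : 0 < 1 - beta by lra.
have dk : delta * (1 - beta) < gamma - beta by rewrite -ltr_pdivlMr.
have d1 : delta <= 1.
  by apply: le_trans (ltW dlt) _; rewrite ler_pdivrMr//; lra.
(* In the deviation exponent eps^2 mu^delta, mu^delta is of order t^(4 th); taking eps of order
   t^(-th) leaves t^(2 th). *)
pose th := delta * (gamma - beta) / 4.
have eta0 : 0 < gamma - beta by rewrite subr_gt0.
have th0 : 0 < th by rewrite /th divr_gt0// mulr_gt0.
(* The power of [t] in the forgetting exponent mu Q^(-delta); it is positive exactly by the upper
   bound on [delta]. *)
pose kap := gamma - beta - delta * (1 - beta).
have kap0 : 0 < kap by rewrite /kap; lra.
pose c1 := (4 / (1 - beta)) `^ (- delta) / 8.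
have c10 : 0 < c1 by rewrite /c1 divr_gt0// powR_gt0// divr_gt0.
pose c2 := mu0 ^+ 2 * 8 `^ (- delta) / 32.
have c20 : 0 < c2 by rewrite /c2 divr_gt0// mulr_gt0 ?exprn_gt0// powR_gt0.
(* A common rate for the three error terms: [c2] is the constant of the deviation bound, and 1/8
   that of the sparse windows. *)
pose c3 := Num.min c2 8^-1.
have c30 : 0 < c3 by rewrite /c3 lt_min c20 invr_gt0 ltr0n.
have c32 : c3 <= c2 by rewrite /c3 ge_min lexx.
have c38 : c3 <= 8^-1 by rewrite /c3 ge_min lexx orbT.
exists th, th; split=> //; split=> //.
(* The second condition yields eps <= 2, the third the forgetting bound; the fourth absorbs the
   factor 4t, and the fifth turns the remaining rate into t^th. *)
have [t0 _ Ht0] : \forall t \near \oo, [/\ (4 <= t)%N,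
    mu0 / 4 <= t%:R `^ th,
    2 / mu0 * t%:R `^ th <= expR (c1 * t%:R `^ kap),
    4 * t%:R `^ 1 <= expR (c3 / 2 * t%:R `^ (2 * th)) &
    2 / c3 <= t%:R `^ th].
  have th20 : 0 < 2 * th by rewrite mulr_gt0.
  near=> t; split; near: t.
  - by exists 4%N.
  - exact: near_le_natr_powR.
  - apply: near_natr_powR_le_expR => //; [by rewrite divr_ge0// ltW | exact: ltW].
  - by apply: near_natr_powR_le_expR => //; rewrite divr_gt0.
  - exact: near_le_natr_powR.
exists t0 => t t1 /Ht0[t4 A1 A2 A3 A4] d T P X Z M s m indep X01 PZ M1 s1 sM sS EX sm.
have tp : 0 < t%:R :> R by rewrite ltr0n.
have tge1 : 1 <= t%:R :> R by rewrite ler1n.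
have tne a : (a == 0 :> R) ==> ((t%:R : R) != 0) by rewrite (lt0r_neq0 tp) implybT.
pose p (i : 'I_t) : R := i.+1%:R `^ (- beta).
pose n := Num.truncn (t%:R `^ gamma : R).
have /andP[n_le n_gt] := truncn_itv (powR_ge0 (t%:R : R) gamma).
have tth : 0 < t%:R `^ th :> R by exact: powR_gt0.
(* Half of the smallest admissible tolerance, leaving room for noise and bias. *)
pose eps := mu0 / 2 / t%:R `^ th.
(* A window has n >= t^gamma / 2 times, each selected with probability at least t^(-beta). *)
pose mu : R := t%:R `^ (gamma - beta) / 2.
pose Q : R := t%:R `^ (1 - beta) / (1 - beta).
have Q0 : 0 < Q by rewrite divr_gt0// powR_gt0.
have mup : 0 < mu by rewrite divr_gt0// powR_gt0.
have eps0 : 0 < eps by rewrite /eps !divr_gt0.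
have s_gt0_le k : (1 <= k)%N -> (k <= M)%N -> (0 < s k)%N.
  elim: k => // -[_ _ _|k IH _ kM]; first by rewrite s1.
  exact: leq_ltn_trans (sS _ _ kM).
have s_le_t k : (1 <= k)%N -> (k <= M)%N -> (s k <= t)%N.
  move=> k1; rewrite -sM => kM.
  have H i : (k + i <= M)%N -> (s k <= s (k + i))%N.
    elim: i => [|i IH]; first by rewrite addn0.
    rewrite addnS => kiM; apply: leq_trans (IH (ltnW kiM)) _; apply: ltnW.
    by apply: sS => //; rewrite addn_gt0 k1.
  by have := H (M - k)%N; rewrite subnKC//; apply.
have p01 i : 0 <= p i <= 1.
  by have /andP[/ltW -> ->] := @natr_powRN_itv R beta i.+1 (ltW b0) isT.
have n_half : t%:R `^ gamma / 2 <= n%:R :> R.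
  have g1 : 1 <= t%:R `^ gamma :> R.
    by have := ler_powR tge1 (_ : 0 <= gamma); rewrite powRr0; apply; lra.
  have := n_gt; rewrite -natr1 -/n => n_gt'.
  have [n0|n0] := posnP n; first by move: n_gt'; rewrite n0; lra.
  have : 1 <= n%:R :> R by rewrite ler1n.
  lra.
have pQ : \sum_i p i <= Q by apply: sum_natr_powRN_le; rewrite (ltW b0) -subr_gt0.
have pmu a : (0 < a)%N -> (a + n <= t.+1)%N ->
    mu <= \sum_(i < t | (a <= i.+1 < a + n)%N) p i.
  move=> a0 an; apply: (@le_trans _ _ (\sum_(i < t | (a <= i.+1 < a + n)%N) t%:R `^ (- beta))).
    rewrite sumr_const (_ : #|_| = n).
      rewrite -[leRHS]mulr_natl; apply: (@le_trans _ _ (t%:R `^ gamma / 2 * t%:R `^ (- beta))).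
        by rewrite /mu powRD// mulrAC.
      by rewrite ler_wpM2r// powR_ge0.
    (* The pattern that selects every time counts the indices of the window. *)
    have := @size_pattern_times_iota t [ffun=> true] a n a0 an.
    rewrite (_ : [seq j <- _ | _] = iota a n) ?size_iota => [E|].
      by rewrite [RHS]E; apply: eq_card => i; rewrite !inE ffunE.
    apply/all_filterP/allP => -[|j]; rewrite mem_iota => /andP[aj ja]; first by move: a0; rewrite ltnNge aj.
    have jt : (j < t)%N by rewrite -ltnS; exact: leq_trans an.
    by rewrite -[j]/(val (Ordinal jt)) pattern_memS ffunE.
  by apply: ler_sum => i _; apply: le_natr_powRN => //; exact: ltW.
have forget : expR (- (mu / 4 * (4 * Q) `^ (- delta))) <= eps.
  have -> : mu / 4 * (4 * Q) `^ (- delta) = c1 * t%:R `^ kap.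
    have -> : 4 * Q = 4 / (1 - beta) * t%:R `^ (1 - beta) by rewrite /Q; ring.
    rewrite powRM ?divr_ge0 ?powR_ge0 ?(ltW b1)// -powRrM /mu /c1 /kap.
    have -> : gamma - beta - delta * (1 - beta) = (gamma - beta) + (1 - beta) * - delta by ring.
    rewrite [X in _ = _ * X]powRD//; by field.
  rewrite expRN /eps -[leRHS]invrK lef_pV2 ?posrE ?expR_gt0 ?invr_gt0//.
  apply: le_trans A2; rewrite le_eqVlt; apply/orP; left; apply/eqP.
  by field; rewrite !gt_eqF.
have eps2 : eps <= 2 by rewrite /eps ler_pdivrMr//; move: A1; lra.
have PZ1 (i : 'I_t) : P [set w | Z i.+1 w = 1] = (p i)%:E.
  by have [] := PZ i.+1 (ltn_ord i).
have d01 : 0 < delta <= 1 by rewrite d0.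
have eps02 : 0 < eps <= 2 by rewrite eps0.
have kM1 k : (k <= M - 1)%N -> (k < M)%N by rewrite leq_subRL// add1n.
have itv k : (1 <= k)%N -> (k <= M - 1)%N ->
    [/\ (0 < s k)%N, (s k + n <= s k.+1)%N & (s k.+1 <= t)%N].
  move=> k1 kM; have kM' := kM1 _ kM; split; [exact: s_gt0_le (ltnW kM')| |exact: s_le_t].
  have [+ _] := sm k k1 kM => gs.
  rewrite -leq_subRL; last exact: ltnW (sS _ k1 kM').
  rewrite -(ler_nat R); apply: le_trans n_le _; apply: le_trans gs.
  by apply: ler_powR => //; exact: ltW.
have mE k j : (1 <= k)%N -> (k <= M - 1)%N -> (s k <= j < s k.+1)%N -> fine 'E_P[X j] = m k.
  by move=> k1 kM sj; rewrite (EX k j).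
have epsm k : (1 <= k)%N -> (k <= M - 1)%N -> 2 * eps <= m k / t%:R `^ th.
  move=> k1 kM; have [_ mk] := sm k k1 kM.
  have -> : 2 * eps = mu0 / t%:R `^ th by rewrite /eps; field; rewrite gt_eqF.
  by rewrite ler_pM2r ?invr_gt0.
apply: le_trans (@Egood_prob_ge d T R P t X Z p indep X01 PZ1 p01 beta gamma delta th eps
  Q mu n M s m d01 eps02 mup Q0 erefl pQ pmu n_le forget itv mE epsm).
rewrite lee_fin lerD2l lerN2.
have T2 : 0 <= t%:R `^ (2 * th) :> R by exact: powR_ge0.
set U := t%:R `^ (2 * th) in A3 T2 *.
have E1 : expR (- Q) <= expR (- (c3 * U)).
  rewrite ler_expR lerN2; apply: (@le_trans _ _ (t%:R `^ (1 - beta))).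
    apply: (@le_trans _ _ U); first by rewrite ler_piMl//; lra.
    by apply: ler_powR => //; rewrite /th; nra.
  by rewrite ler_pdivlMr// ler_piMr ?powR_ge0//; lra.
have E2 : expR (- (mu / 4)) <= expR (- (c3 * U)).
  rewrite ler_expR lerN2 /mu.
  have : U <= t%:R `^ (gamma - beta) by apply: ler_powR => //; rewrite /th; nra.
  nra.
have E3 : expR (- (eps ^+ 2 * (mu / 4) `^ delta / 8)) <= expR (- (c3 * U)).
  rewrite ler_expR lerN2.
  have -> : eps ^+ 2 * (mu / 4) `^ delta / 8 = c2 * U; last by rewrite ler_wpM2r.
  have -> : mu / 4 = 8^-1 * t%:R `^ (gamma - beta) by rewrite /mu; field.
  have E8 : 8^-1 `^ delta = 8 `^ (- delta) :> R by rewrite -[8^-1]powR_inv1// -powRrM mulN1r.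
  rewrite powRM ?powR_ge0 ?invr_ge0// -powRrM E8.
  have -> : (gamma - beta) * delta = th + (th + 2 * th) by rewrite /th; field.
  rewrite [t%:R `^ (th + (th + _))]powRD// [t%:R `^ (th + 2 * th)]powRD// -/U /c2 /eps.
  by field; rewrite gt_eqF.
(* The coefficients add up to 1 + t + 2t, which is at most 4t. *)
apply: (@le_trans _ _ (4 * t%:R * expR (- (c3 * U)))).
  have e0 : 0 <= expR (- (c3 * U)) by exact: expR_ge0.
  apply: (@le_trans _ _ (expR (- (c3 * U)) + t%:R * expR (- (c3 * U)) + t%:R * (2 * expR (- (c3 * U))))).
    by apply: lerD; [apply: lerD => //|]; rewrite ler_pM2l// ler_pM2l.
  nra.
rewrite powRr1// in A3.
(* Half of the rate pays for 4t. The other half is (c3/2) W^2 with W = t^th, and this is at least W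
   because W >= 2/c3. *)
apply: (@le_trans _ _ (expR (c3 / 2 * U) * expR (- (c3 * U)))).
  by rewrite ler_wpM2r ?expR_ge0.
rewrite -expRD ler_expR.
have UE : U = t%:R `^ th * t%:R `^ th.
  by rewrite /U (_ : 2 * th = th + th) ?powRD//; ring.
move: A4; rewrite ler_pdivrMr// UE; move: tth; set W := t%:R `^ th; nra.
Unshelve. all: by end_near.
Qed.
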